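(* Let $\mathcal{A}$ be either the quaternions $\mathbb{H}$ or the octonions $\mathbb{O}$, and let $S=\{t\in\mathcal{A} : |t|=1\}$ be the unit sphere in $\mathcal{A}$. Let $f,g:S\to S$ be smooth and let $F:S\to S$ be defined by $F(t)=f(t)*g(t)$, where $*$ is the multiplication of $\mathcal{A}$. Then $\deg(F)=\deg(f)+\deg(g)$.
   Context: $\mathbb{H}$ is the real algebra of quaternions with basis $1, \mathbf{i}, \mathbf{j}, \mathbf{k}$, where $\mathbf{i}^2=\mathbf{j}^2=\mathbf{k}^2=-1$, $\mathbf{i}\mathbf{j}=-\mathbf{j}\mathbf{i}=\mathbf{k}$, $\mathbf{j}\mathbf{k}=-\mathbf{k}\mathbf{j}=\mathbf{i}$, $\mathbf{k}\mathbf{i}=-\mathbf{i}\mathbf{k}=\mathbf{j}$. $\mathbb{O}$ is the (non-associative, alternative) real algebra of octonions with basis $1, \mathbf{e}_1, \dots, \mathbf{e}_7$, where $\mathbf{e}_k^2=-1$ and each of the triples $(\mathbf{e}_1,\mathbf{e}_2,\mathbf{e}_3)$, $(\mathbf{e}_1,\mathbf{e}_4,\mathbf{e}_5)$, $(\mathbf{e}_1,\mathbf{e}_6,\mathbf{e}_7)$, $(\mathbf{e}_2,\mathbf{e}_6,\mathbf{e}_4)$, $(\mathbf{e}_2,\mathbf{e}_5,\mathbf{e}_7)$, $(\mathbf{e}_3,\mathbf{e}_4,\mathbf{e}_7)$, $(\mathbf{e}_3,\mathbf{e}_5,\mathbf{e}_6)$ multiplies like $(\mathbf{i},\mathbf{j},\mathbf{k})$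 in $\mathbb{H}$. The norm $|\cdot|$ is the Euclidean norm in the given basis; it is multiplicative, so $S$ (which is $S^3$ or $S^7$) is closed under $*$. $\deg$ denotes the topological (Brouwer) degree of a map $S\to S$. *)

(* Defs.v *)
From HB Require Import structures.
From mathcomp Require Import all_boot all_order all_algebra.
From mathcomp Require Import ring.
From mathcomp Require Import all_classical all_reals.
From mathcomp Require Import topology normedtype derive.
From mathcomp Require Import freeg.

Set Implicit Arguments.
Unset Strict Implicit.
Unset Printing Implicit Defensive.

Import Order.TTheory GRing.Theory Num.Theory.
Import numFieldNormedType.Exports.

Local Open Scope classical_set_scope.
Local Open Scope ring_scope.

(** * Quaternions and octonions *)

Inductive algebra : Set := Quaternions | Octonions.

(* Elements of an algebra of dimension [(sdim A).+1] are coordinate vectors in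
   the basis 1, e_1, ..., e_(sdim A), the index 0 being that of the unit;
   [sdim A] is the dimension of the unit sphere. *)
Definition sdim (A : algebra) : nat :=
  match A with Quaternions => 3 | Octonions => 7 end.

Definition triples (A : algebra) : seq (nat * nat * nat) :=
  match A with
  | Quaternions => [:: (1, 2, 3)]
  | Octonions => [:: (1, 2, 3); (1, 4, 5); (1, 6, 7); (2, 6, 4);
                     (2, 5, 7); (3, 4, 7); (3, 5, 6)]
  end%N.

Definition cyclic_triple (A : algebra) (i j k : nat) : bool :=
  [|| (i, j, k) \in triples A, (j, k, i) \in triples A
    | (k, i, j) \in triples A].

(* The coefficient of e_k in e_i * e_j. *)
Definition structure_constant (R : pzRingType) (A : algebra) (i j k : nat) : R :=
  if i == 0%N then (j == k)%:R
  else if j == 0%N then (i == k)%:R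
  else if i == j then - (k == 0%N)%:R
  else (cyclic_triple A i j k)%:R - (cyclic_triple A j i k)%:R.

Definition amul (R : pzRingType) (A : algebra) (x y : 'rV[R]_(sdim A).+1) :
    'rV[R]_(sdim A).+1 :=
  \row_k \sum_(i < (sdim A).+1) \sum_(j < (sdim A).+1)
    structure_constant R A i j k * (x 0 i * y 0 j).

(** * Unit spheres *)

(* The library norm on ['rV[R]_n] is the sup norm, hence this definition. *)
Definition enorm (R : realType) (n : nat) (x : 'rV[R]_n) : R :=
  Num.sqrt (\sum_i x 0 i ^+ 2).

Definition sphere (R : realType) (n : nat) : set 'rV[R]_n.+1 :=
  [set x | enorm x = 1].
Arguments sphere R n : clear implicits.

Definition sconst_pos (A : algebra) (i j k : nat) : bool :=
  if i == 0%N then j == k else if j == 0%N then i == k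
  else (i != j) && cyclic_triple A i j k.

Definition sconst_neg (A : algebra) (i j k : nat) : bool :=
  [&& i != 0%N, j != 0%N & if i == j then k == 0%N else cyclic_triple A j i k].

Lemma structure_constantE (R : pzRingType) A i j k :
  structure_constant R A i j k =
    (sconst_pos A i j k)%:R - (sconst_neg A i j k)%:R.
Proof.
rewrite /structure_constant /sconst_pos /sconst_neg.
case: (i == 0%N); rewrite ?subr0 //; case: (j == 0%N); rewrite ?subr0 //=.
by case: (i == j); rewrite ?sub0r.
Qed.

(* For all i and k exactly one j satisfies e_i * e_j = +-e_k. *)
Definition partner A i k : nat :=
  find (fun j => sconst_pos A i j k || sconst_neg A i j k) (iota 0 (sdim A).+1).

Lemma partnerP A i j k : (i < (sdim A).+1)%N -> (j < (sdim A).+1)%N ->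
    (k < (sdim A).+1)%N ->
  [&& (partner A i k < (sdim A).+1)%N,
      sconst_pos A i j k ==
        (j == partner A i k) && ~~ sconst_neg A i (partner A i k) k &
      sconst_neg A i j k ==
        (j == partner A i k) && sconst_neg A i (partner A i k) k].
Proof.
have: all (fun i => all (fun j => all (fun k =>
  [&& (partner A i k < (sdim A).+1)%N,
      sconst_pos A i j k ==
        (j == partner A i k) && ~~ sconst_neg A i (partner A i k) k &
      sconst_neg A i j k ==
        (j == partner A i k) && sconst_neg A i (partner A i k) k])
  (iota 0 (sdim A).+1)) (iota 0 (sdim A).+1)) (iota 0 (sdim A).+1).
  by case: A; vm_compute.
move=> /allP + ilt jlt klt => /(_ i); rewrite mem_iota => /(_ ilt).
move=> /allP /(_ j); rewrite mem_iota => /(_ jlt).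
by move=> /allP /(_ k); rewrite mem_iota => /(_ klt).
Qed.

Lemma amulE (R : pzRingType) A (x y : 'rV[R]_(sdim A).+1) (k : 'I_(sdim A).+1) :
  amul x y 0 k = \sum_(0 <= i < (sdim A).+1)
    (-1) ^+ sconst_neg A i (partner A i k) k *
      (x 0 (inord i) * y 0 (inord (partner A i k))).
Proof.
rewrite mxE big_mkord; apply: eq_bigr => i _; rewrite inord_val.
have /and3P[plt _ _] := partnerP (ltn_ord i) (ltn_ord i) (ltn_ord k).
rewrite (bigD1 (inord (partner A i k))) //= big1 ?addr0 => [|j neq].
  rewrite structure_constantE inordK //.
  have /and3P[_ /eqP -> _] := partnerP (ltn_ord i) plt (ltn_ord k).
  by rewrite eqxx; case: sconst_neg; rewrite /= ?sub0r ?subr0 ?expr0 ?expr1.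
rewrite structure_constantE.
have /and3P[_ /eqP -> /eqP ->] := partnerP (ltn_ord i) (ltn_ord j) (ltn_ord k).
suff -> : (nat_of_ord j == partner A i k) = false by rewrite subrr mul0r.
by apply: contraNF neq => /eqP <-; rewrite inord_val.
Qed.

Lemma amul_norm2 (R : comPzRingType) (A : algebra) (x y : 'rV[R]_(sdim A).+1) :
  \sum_k amul x y 0 k ^+ 2 = (\sum_i x 0 i ^+ 2) * (\sum_j y 0 j ^+ 2).
Proof.
have sumE (F : 'I_(sdim A).+1 -> R) :
    \sum_k F k = \sum_(0 <= k < (sdim A).+1) F (inord k).
  by rewrite big_mkord; apply: eq_bigr => i _; rewrite inord_val.
rewrite !sumE.
under eq_big_nat => k /andP[_ klt] do rewrite amulE inordK //.
pose a i := x 0 (inord i); pose b i := y 0 (inord i).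
rewrite -[LHS]/(\sum_(0 <= k < (sdim A).+1) (\sum_(0 <= i < (sdim A).+1)
  (-1) ^+ sconst_neg A i (partner A i k) k * (a i * b (partner A i k))) ^+ 2).
rewrite -[RHS]/((\sum_(0 <= k < (sdim A).+1) a k ^+ 2) *
  (\sum_(0 <= k < (sdim A).+1) b k ^+ 2)).
move: a b; case: A x y sumE => _ _ _ a b; rewrite unlock /=.
  ring.
repeat match goal with |- context [partner ?A ?i ?k] =>
  let v := eval vm_compute in (partner A i k) in
  change (partner A i k) with v end.
move: (a 0%N) (a 1%N) (a 2%N) (a 3%N) (a 4%N) (a 5%N) (a 6%N) (a 7%N)
  => {a} a0 a1 a2 a3 a4 a5 a6 a7.
move: (b 0%N) (b 1%N) (b 2%N) (b 3%N) (b 4%N) (b 5%N) (b 6%N) (b 7%N)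
  => {b} b0 b1 b2 b3 b4 b5 b6 b7.
rewrite ?(expr0, expr1, mul1r, mulN1r, addr0).
by ring.
Qed.

Lemma amul_sphere (R : realType) (A : algebra) (x y : sphere R (sdim A)) :
  amul (set_val x) (set_val y) \in sphere R (sdim A).
Proof.
have [xS yS] := (set_valP x, set_valP y).
apply/mem_set; rewrite /sphere /= /enorm amul_norm2 sqrtrM.
  by rewrite -!/(enorm _) xS yS mulr1.
by apply: sumr_ge0 => i _; exact: sqr_ge0.
Qed.

Definition sphere_mul (R : realType) (A : algebra) (x y : sphere R (sdim A)) :
    sphere R (sdim A) :=
  SigSub (amul_sphere x y).

(** * Smooth maps *)

Definition iter_partial (R : realType) (m n : nat) (s : seq 'I_m.+1)
    (G : 'rV[R]_m.+1 -> 'rV[R]_n.+1) : 'rV[R]_m.+1 -> 'rV[R]_n.+1 :=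
  foldr (fun i H x => 'D_(delta_mx 0 i) H x) G s.

(* C^oo on [U], meant for [U] open. *)
Definition smooth_on (R : realType) (m n : nat) (U : set 'rV[R]_m.+1)
    (G : 'rV[R]_m.+1 -> 'rV[R]_n.+1) : Prop :=
  forall (s : seq 'I_m.+1) (x : 'rV[R]_m.+1), U x ->
    {for x, continuous (iter_partial s G)} /\
    forall i : 'I_m.+1, derivable (iter_partial s G) x (delta_mx 0 i).

(* A map between subsets of Euclidean spaces is smooth when it locally extends
   to a smooth map on an open subset of the ambient space. *)
Definition smooth (R : realType) (m n : nat) (f : sphere R m -> sphere R n) :
    Prop :=
  forall t : sphere R m, exists (U : set 'rV[R]_m.+1)
      (G : 'rV[R]_m.+1 -> 'rV[R]_n.+1),
    [/\ open U, U (set_val t), smooth_on U G &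
        forall s : sphere R m, U (set_val s) -> set_val (f s) = G (set_val s)].

(** * Singular homology and the degree *)

Definition stdsimplex (R : realType) (n : nat) : set 'rV[R]_n.+1 :=
  [set x | (forall i, 0 <= x 0 i) /\ \sum_i x 0 i = 1].
Arguments stdsimplex R n : clear implicits.

Lemma face_subproof (R : realType) (n : nat) (i : 'I_n.+2)
    (x : stdsimplex R n) :
  \row_(j < n.+2) (if unlift i j is Some k then set_val x 0 k else 0)
    \in stdsimplex R n.+1.
Proof.
have [x_ge0 x_sum] := set_valP x; apply/mem_set; split=> [j|].
  by rewrite mxE; case: unliftP => [k _|_].
rewrite (bigD1_ord i) //= mxE unlift_none add0r -[RHS]x_sum.
by apply: eq_bigr => k _; rewrite mxE liftK.
Qed.

Definition face (R : realType) (n : nat) (i : 'I_n.+2) (x : stdsimplex R n) :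
    stdsimplex R n.+1 :=
  SigSub (face_subproof i x).

(* The free abelian group on all maps from the standard simplex to [X]; the
   group of singular chains is its subgroup [singular], spanned by the
   continuous maps. *)
Definition chain (R : realType) (n : nat) (X : topologicalType) :=
  {freeg (stdsimplex R n -> X) / int}.

Definition singular (R : realType) (n : nat) (X : topologicalType)
    (c : chain R n X) : Prop :=
  forall sigma : stdsimplex R n -> X, sigma \in dom c -> continuous sigma.

Definition boundary (R : realType) (n : nat) (X : topologicalType)
    (c : chain R n.+1 X) : chain R n X :=
  fglift (fun sigma : stdsimplex R n.+1 -> X =>
    \sum_(i < n.+2) [freeg [:: ((-1) ^+ i : int, sigma \o face i)]]) c.

Definition pushforward (R : realType) (n : nat) (X Y : topologicalType)
    (f : X -> Y) (c : chain R n X) : chain R n Y :=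
  fglift (fun sigma : stdsimplex R n -> X =>
    [freeg [:: (1 : int, f \o sigma)]]) c.

Definition is_cycle (R : realType) (n : nat) (X : topologicalType) :
    chain R n X -> Prop :=
  match n return chain R n X -> Prop with
  | 0 => fun=> True
  | m.+1 => fun c => boundary c = 0
  end.

(* [f] acts as multiplication by [d] on the singular homology group
   H_n(X; Z). *)
Definition acts_by (R : realType) (n : nat) (X : topologicalType) (f : X -> X)
    (d : int) : Prop :=
  forall c : chain R n X, singular c -> is_cycle c ->
    exists b : chain R n.+1 X,
      singular b /\ pushforward f c - c *~ d = boundary b.

(* The degree, for n > 0, of a continuous self-map of the n-sphere: the unique
   integer by which the map acts on H_n(S^n; Z), which is infinite cyclic
   (0 is a junk value, for maps that are not continuous). *)
Definition degree (R : realType) (n : nat) (f : sphere R n -> sphere R n) :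
    int :=
  xget 0 [set d : int | acts_by R n f d].

(* Main.v *)
(** A map acts on the infinite cyclic group [H_n(S)] ([n] = 3 or 7) as
    multiplication by its degree, so the claim is [F_* z = f_* z + g_* z] for a
    generating cycle [z].  Let [p] and [q] be maps homotopic to the identity
    such that [p] is constant on the cap [x_0 < 1/2] and [q] is constant on the
    cap [x_0 > -1/2].  Then [F] is homotopic to [(f o p) * (g o q)], which is
    [f o p] times a constant on one cap and a constant times [g o q] on the
    other.  Writing [z] as a sum of chains in the two caps gives the result,
    because multiplication by a constant is homotopic to the identity and
    constant simplices of odd dimension are boundaries.

    That [H_n(S)] is infinite cyclic comes from Mayer-Vietoris in a fixed
    Euclidean space [E]: with [Y_k] the set of points having a nonzero
    coordinate of index below [k], [Y_(k+1)] is the union of two open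
    star-shaped sets whose intersection is [Y_k], and [E] minus the origin
    retracts to the sphere.  Subdivision and homotopy invariance are both
    obtained from cones over affine simplices. *)

From HB Require Import structures.
Require Import Defs.
From mathcomp Require Import all_boot all_order all_algebra.
From mathcomp Require Import zify ring lra.
From mathcomp Require Import all_classical all_reals.
From mathcomp Require Import topology normedtype sequences realfun.
From mathcomp Require Import freeg.

Set Implicit Arguments.
Unset Strict Implicit.
Unset Printing Implicit Defensive.

Import Order.TTheory GRing.Theory Num.Theory.
Import numFieldNormedType.Exports.

Local Open Scope classical_set_scope.
Local Open Scope ring_scope.

(* [freeg] also exports a [lift]. *)
Local Notation lift := fintype.lift.

(** * Free abelian groups *)

(** [degree f] is characterized only by its action on all cycles, with a junk value when no integer
    works. Computing it takes both halves of [freely_generates]: generation turns a relation on [z]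
    into an action on every cycle, freeness makes the integer unique.

    The pieces of a cycle over the two caps are chains, not cycles, so they have no homology classes
    to add up. The comparison is therefore made on chains: over each cap the product equals, simplex
    by simplex, a map with one factor frozen, and the leftover terms consist of constant simplices,
    which bound in odd dimension whether or not the piece is a cycle.

    The multiplication enters through bilinearity, the unit and the multiplicative norm: [x * d] and
    [x * d'] are antipodal only if [d] and [d'] are. The basic homotopies on the sphere are thus
    normalized segments between maps that are nowhere antipodal, and both algebras are treated at
    once.

    Staying inside one Euclidean space in Mayer-Vietoris avoids suspensions and comparisons between
    spheres of different dimensions. *)

Section FreeAbelianGroup.
Variable K : choiceType.
Implicit Types (x : K) (D : {freeg K / int}).

Definition gen x : {freeg K / int} := [freeg [:: (1, x)]].

Lemma freegUE (k : int) x : [freeg [:: (k, x)]] = gen x *~ k.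
Proof. by rewrite /gen freeg_mulz mulrzz mul1r. Qed.

HB.instance Definition _ (M : lmodType int) (f : K -> M) :=
  GRing.isZmodMorphism.Build {freeg K / int} M (fglift f) (lift_is_additive f).

Lemma fglift_gen (M : lmodType int) (f : K -> M) x : fglift f (gen x) = f x.
Proof. by rewrite /gen liftU scale1r. Qed.

Lemma deg_gen x : deg (gen x) = 1.
Proof. exact: degU. Qed.

(** A condition on the support. Chains are built on arbitrary maps, so continuity, containment in an
    open set and mesh bounds are all expressed this way. *)
Definition on (P : K -> Prop) D := forall x, x \in dom D -> P x.

Lemma on0 P : on P 0.
Proof. by move=> x; rewrite dom0. Qed.

Lemma on_gen (P : K -> Prop) x : P x -> on P (gen x).
Proof. by move=> Px y; rewrite domU1 inE => /eqP ->. Qed.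

Lemma onD P D1 D2 : on P D1 -> on P D2 -> on P (D1 + D2).
Proof.
by move=> P1 P2 x /domD_subset; rewrite mem_cat => /orP[/P1|/P2].
Qed.

Lemma onN P D : on P D -> on P (- D).
Proof. by move=> PD x; rewrite domN => /PD. Qed.

Lemma onB P D1 D2 : on P D1 -> on P D2 -> on P (D1 - D2).
Proof. by move=> P1 P2; exact: onD P1 (onN P2). Qed.

Lemma onMn P D (k : nat) : on P D -> on P (D *+ k).
Proof.
move=> PD; elim: k => [|k IH]; first by rewrite mulr0n; exact: on0.
by rewrite mulrS; exact: onD.
Qed.

Lemma onMz P D (k : int) : on P D -> on P (D *~ k).
Proof.
move=> PD; case: k => k; first exact: onMn.
by rewrite NegzE mulrNz -pmulrn; apply: onN; exact: onMn.
Qed.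

Lemma on_sum P (I : Type) (r : seq I) (Q : pred I) (F : I -> {freeg K / int}) :
  (forall i, Q i -> on P (F i)) -> on P (\sum_(i <- r | Q i) F i).
Proof. by move=> PF; elim/big_ind : _ => //; [exact: on0|exact: onD]. Qed.

Lemma sub_on (P Q : K -> Prop) D : (forall x, P x -> Q x) -> on P D -> on Q D.
Proof. by move=> PQ PD x /PD /PQ. Qed.

Lemma onI (P Q : K -> Prop) D :
  on P D -> on Q D -> on (fun x => P x /\ Q x) D.
Proof. by move=> PD QD x xD; split; [exact: PD|exact: QD]. Qed.

(** An element lies in the subgroup generated by its own support, and over the integers closure
    under subtraction yields all multiples. *)
Lemma on_ind (P : K -> Prop) (Q : {freeg K / int} -> Prop) D :
  Q 0 -> (forall D1 D2, Q D1 -> Q D2 -> Q (D1 - D2)) ->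
  (forall x, P x -> Q (gen x)) -> on P D -> Q D.
Proof.
move=> Q0 QB Qgen PD; rewrite -(freeg_sumE D) big_seq.
have QN D1 : Q D1 -> Q (- D1) by move=> Q1; rewrite -sub0r; exact: QB.
have QD D1 D2 : Q D1 -> Q D2 -> Q (D1 + D2).
  by move=> Q1 Q2; rewrite -[D2]opprK; apply/QB/QN.
elim/big_ind: _ => // x xD; rewrite freegUE.
have Qn (n : nat) : Q (gen x *+ n).
  elim: n => [|n IH]; first by rewrite mulr0n.
  by rewrite mulrS; apply: QD => //; exact/Qgen/PD.
by case: (coeff x D) => n; rewrite ?NegzE ?mulrNz; [exact: Qn|exact/QN/Qn].
Qed.

Lemma additive_eq_on (P : K -> Prop) (M : zmodType)
    (f g : {additive {freeg K / int} -> M}) D :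
  (forall x, P x -> f (gen x) = g (gen x)) -> on P D -> f D = g D.
Proof.
move=> fg; elim/on_ind => [|D1 D2 E1 E2|x /fg //]; first by rewrite !raddf0.
by rewrite !raddfB E1 E2.
Qed.

Lemma additive_eq (M : zmodType) (f g : {additive {freeg K / int} -> M}) D :
  (forall x, f (gen x) = g (gen x)) -> f D = g D.
Proof. by move=> fg; exact: (@additive_eq_on (fun=> True)). Qed.

Lemma on_split (P Q : K -> Prop) D : on (fun x => P x \/ Q x) D ->
  exists D1 D2, [/\ D = D1 + D2, on P D1 & on Q D2].
Proof.
elim/on_ind => [|D1 D2 [a1 [b1 [-> Pa1 Qb1]]] [a2 [b2 [-> Pa2 Qb2]]]|x].
- by exists 0, 0; split; [rewrite addr0|exact: on0|exact: on0].
- exists (a1 - a2), (b1 - b2).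
  by split; [rewrite opprD addrACA|exact: onB|exact: onB].
- case=> [Px|Qx].
    by exists (gen x), 0; split; [rewrite addr0|exact: on_gen|exact: on0].
  by exists 0, (gen x); split; [rewrite add0r|exact: on0|exact: on_gen].
Qed.

End FreeAbelianGroup.

Lemma on_fglift (K L : choiceType) (P : K -> Prop) (Q : L -> Prop)
    (f : K -> {freeg L / int}) (D : {freeg K / int}) :
  (forall x, P x -> on Q (f x)) -> on P D -> on Q (fglift f D).
Proof.
move=> PQ; elim/on_ind => [|D1 D2 Q1 Q2|x /PQ]; rewrite ?raddf0 ?raddfB.
- exact: on0.
- exact: onB.
- by rewrite fglift_gen.
Qed.

(** * Affine chains *)

Section AffineChains.
Variable R : realType.

(* Affine simplices with [n] vertices in R^m, listed as the rows of a matrix;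
   the empty simplex makes the complex augmented. *)
Definition affine (n m : nat) := {freeg 'M[R]_(n, m) / int}.

Definition abound (n m : nat) : affine n.+1 m -> affine n m :=
  fglift (fun M => \sum_(i < n.+1) gen (row' i M) *~ ((-1) ^+ i)).

Definition cone (n m : nat) (b : 'rV[R]_m) : affine n m -> affine n.+1 m :=
  fglift (fun M => gen (col_mx b M : 'M_(n.+1, m))).

Definition amulmx (n m k : nat) (N : 'M[R]_(m, k)) : affine n m -> affine n k :=
  fglift (fun M => gen (M *m N)).

HB.instance Definition _ n m := GRing.Additive.on (@abound n m).
HB.instance Definition _ n m b := GRing.Additive.on (@cone n m b).
HB.instance Definition _ n m k N := GRing.Additive.on (@amulmx n m k N).

(** [1 + n] and [n.+1] are convertible, but the indices produced by [col_mxEu] differ from [ord0] in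
    their bound proofs, hence [val_inj]. *)
Lemma col_mx_ord0 (n m : nat) (b : 'rV[R]_m) (M : 'M_(n, m)) j :
  (col_mx b M : 'M_(n.+1, m)) ord0 j = b 0 j.
Proof. by rewrite -(col_mxEu b M); congr (col_mx b M _ j); exact: val_inj. Qed.

Lemma col_mx_lift0 (n m : nat) (b : 'rV[R]_m) (M : 'M_(n, m)) (i : 'I_n) j :
  (col_mx b M : 'M_(n.+1, m)) (lift ord0 i) j = M i j.
Proof. by rewrite -(col_mxEd b M); congr (col_mx b M _ j); exact: val_inj. Qed.

Lemma row'0_col_mx (n m : nat) (b : 'rV[R]_m) (M : 'M_(n, m)) :
  row' (ord0 : 'I_n.+1) (col_mx b M : 'M_(n.+1, m)) = M.
Proof. by apply/matrixP => i j; rewrite [LHS]mxE col_mx_lift0. Qed.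

Lemma row'S_col_mx (n m : nat) (b : 'rV[R]_m) (M : 'M_(n.+1, m)) i :
  row' (lift ord0 i : 'I_n.+2) (col_mx b M : 'M_(n.+2, m)) =
  (col_mx b (row' i M) : 'M_(n.+1, m)).
Proof.
apply/matrixP => p j; rewrite [LHS]mxE.
case: (unliftP ord0 p) => [q|] ->; last first.
  rewrite [RHS]col_mx_ord0 -(col_mx_ord0 b M); congr (col_mx b M _ j).
  exact: val_inj.
rewrite [RHS]col_mx_lift0 [RHS]mxE -(col_mx_lift0 b M); congr (col_mx _ _ _ _).
by apply: val_inj; rewrite /= /bump /= !add1n ltnS addnS.
Qed.

Lemma abound_gen (n m : nat) (M : 'M_(n.+1, m)) :
  abound (gen M) = \sum_(i < n.+1) gen (row' i M) *~ ((-1) ^+ i).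
Proof. exact: fglift_gen. Qed.

Lemma cone_gen (n m : nat) b (M : 'M_(n, m)) :
  cone b (gen M) = gen (col_mx b M : 'M_(n.+1, m)).
Proof. exact: fglift_gen. Qed.

Lemma amulmx_gen (n m k : nat) (N : 'M[R]_(m, k)) (M : 'M_(n, m)) :
  amulmx N (gen M) = gen (M *m N).
Proof. exact: fglift_gen. Qed.

(** In the lowest degree the augmented cone formula has no correction term: deleting the apex of a
    point leaves the empty simplex. *)
Lemma abound_cone0 (m : nat) b (c : affine 0 m) : abound (cone b c) = c.
Proof.
apply: (additive_eq (f := @abound 0 m \o cone b) (g := idfun)) => M /=.
by rewrite cone_gen abound_gen big_ord1 expr0 mulr1z row'0_col_mx.
Qed.

Lemma abound_cone (n m : nat) b (c : affine n.+1 m) :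
  abound (cone b c) = c - cone b (abound c).
Proof.
apply: (additive_eq (f := @abound n.+1 m \o cone b)
  (g := idfun \- (cone b \o @abound n m))) => M /=.
rewrite cone_gen !abound_gen big_ord_recl expr0 mulr1z row'0_col_mx.
congr (_ + _); rewrite raddf_sum -sumrN; apply: eq_bigr => i _ /=.
by rewrite row'S_col_mx exprS mulN1r mulrNz (raddfMz (cone b)) /= cone_gen.
Qed.

(** Every simplex is the cone from its first vertex over the remaining ones, so the cone formula
    gives the result by induction, without pairing signs in a double sum. *)
Lemma abound_abound (n m : nat) (c : affine n.+2 m) : abound (abound c) = 0.
Proof.
elim: n c => [|n IH] c.
  apply: (additive_eq (f := @abound 0 m \o @abound 1 m) (g := \0)) => M /=.
  rewrite -[M](@vsubmxK _ 1) -cone_gen abound_cone raddfB /=.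
  by rewrite abound_cone0 subrr.
apply: (additive_eq (f := @abound n.+1 m \o @abound n.+2 m) (g := \0)) => M /=.
rewrite -[M](@vsubmxK _ 1) -cone_gen abound_cone raddfB /=.
by rewrite abound_cone IH raddf0 subr0 subrr.
Qed.

Lemma amulmx_abound (n m k : nat) (N : 'M[R]_(m, k)) (c : affine n.+1 m) :
  amulmx N (abound c) = abound (amulmx N c).
Proof.
apply: (additive_eq (f := amulmx N \o @abound n m)
  (g := @abound n k \o amulmx N)) => M /=.
rewrite amulmx_gen !abound_gen raddf_sum; apply: eq_bigr => i _.
rewrite (raddfMz (amulmx N)) /= amulmx_gen; congr (gen _ *~ _).
by apply/matrixP => p j; rewrite !mxE; apply: eq_bigr => q _; rewrite mxE.
Qed.

Lemma amulmx_cone (n m k : nat) (N : 'M[R]_(m, k)) b (c : affine n m) :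
  amulmx N (cone b c) = cone (b *m N) (amulmx N c).
Proof.
apply: (additive_eq (f := amulmx N \o cone b)
  (g := cone (b *m N) \o amulmx N)) => M /=.
rewrite amulmx_gen !cone_gen amulmx_gen; exact: (congr1 (@gen _) (mul_col_mx b M N)).
Qed.

(** * Barycentric subdivision of affine chains *)

Definition barycenter (n m : nat) (M : 'M[R]_(n.+1, m)) : 'rV[R]_m :=
  const_mx n.+1%:R^-1 *m M.

(** Starting at the empty simplex makes a vertex its own subdivision without a separate clause. *)
Fixpoint subdivision (n m : nat) : affine n m -> affine n m :=
  match n with
  | 0 => idfun
  | n'.+1 => fglift (fun M : 'M_(n'.+1, m) =>
      cone (barycenter M) (subdivision (abound (gen M))))
  end.

Lemma subdivision_is_additive n m : zmod_morphism (@subdivision n m).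
Proof. by case: n => [|n] /= x y; rewrite ?raddfB. Qed.

HB.instance Definition _ n m :=
  GRing.isZmodMorphism.Build _ _ _ (@subdivision_is_additive n m).

Arguments subdivision : simpl never.

Lemma subdivision_gen (n m : nat) (M : 'M_(n.+1, m)) :
  subdivision (gen M) = cone (barycenter M) (subdivision (abound (gen M))).
Proof. exact: fglift_gen. Qed.

Lemma abound_subdivision (n m : nat) (c : affine n.+1 m) :
  abound (subdivision c) = subdivision (abound c).
Proof.
elim: n c => [|n IH] c.
  apply: (additive_eq (f := @abound 0 m \o @subdivision 1 m)
    (g := @subdivision 0 m \o @abound 0 m)) => M /=.
  by rewrite subdivision_gen abound_cone0.
apply: (additive_eq (f := @abound n.+1 m \o @subdivision n.+2 m)
  (g := @subdivision n.+1 m \o @abound n.+1 m)) => M /=.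
by rewrite subdivision_gen abound_cone IH abound_abound raddf0 raddf0 subr0.
Qed.

Lemma amulmx_subdivision (n m k : nat) (N : 'M[R]_(m, k)) (c : affine n m) :
  amulmx N (subdivision c) = subdivision (amulmx N c).
Proof.
elim: n c => [//|n IH] c.
apply: (additive_eq (f := amulmx N \o @subdivision n.+1 m)
  (g := @subdivision n.+1 k \o amulmx N)) => M /=.
rewrite amulmx_gen !subdivision_gen amulmx_cone IH amulmx_abound amulmx_gen.
by rewrite /barycenter mulmxA.
Qed.

(** * Convexity and mesh *)

Definition rows_in (n m : nat) (K : set 'rV[R]_m) (M : 'M_(n, m)) : Prop :=
  forall i, K (row i M).

Definition convex_set (m : nat) (K : set 'rV[R]_m) : Prop :=
  forall n (M : 'M_(n.+1, m)) p, stdsimplex R n p -> rows_in K M -> K (p *m M).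

Lemma rows_in_row' n m (K : set 'rV_m) (M : 'M_(n.+1, m)) i :
  rows_in K M -> rows_in K (row' i M).
Proof.
move=> KM j; suff -> : row j (row' i M) = row (lift i j) M by [].
by apply/rowP => k; rewrite !mxE.
Qed.

Lemma rows_in_col_mx n m (K : set 'rV_m) (M : 'M_(n, m)) b :
  K b -> rows_in K M -> rows_in K (col_mx b M : 'M_(n.+1, m)).
Proof.
move=> Kb KM i; case: (unliftP ord0 i) => [j|] ->.
  suff -> : row (lift ord0 j) (col_mx b M : 'M_(n.+1, m)) = row j M by [].
  by apply/rowP => k; rewrite mxE col_mx_lift0 mxE.
suff -> : row ord0 (col_mx b M : 'M_(n.+1, m)) = b by [].
by apply/rowP => k; rewrite mxE col_mx_ord0.
Qed.

Lemma on_abound n m (P : 'M[R]_(n.+1, m) -> Prop) (Q : 'M[R]_(n, m) -> Prop) c :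
  (forall M i, P M -> Q (row' i M)) -> on P c -> on Q (abound c).
Proof.
move=> PQ; apply: on_fglift => M PM; apply: on_sum => i _.
by apply: onMz; apply: on_gen; exact: PQ.
Qed.

Lemma on_cone n m (P : 'M[R]_(n, m) -> Prop) (Q : 'M[R]_(n.+1, m) -> Prop) b c :
  (forall M, P M -> Q (col_mx (b : 'rV_m) M)) -> on P c -> on Q (cone b c).
Proof. by move=> PQ; apply: on_fglift => M PM; apply: on_gen; exact: PQ. Qed.

Lemma const_stdsimplex n : stdsimplex R n (const_mx n.+1%:R^-1).
Proof.
split=> [i|]; first by rewrite mxE invr_ge0.
under eq_bigr => i _ do rewrite mxE.
by rewrite sumr_const card_ord -[LHS]mulr_natr mulVf // pnatr_eq0.
Qed.

Lemma on_subdivision n m (K : set 'rV_m) (c : affine n m) :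
  convex_set K -> on (rows_in K) c -> on (rows_in K) (subdivision c).
Proof.
move=> cK; elim: n c => [//|n IH] c; apply: on_fglift => M KM.
apply: on_cone (IH _ _) => [N|].
  by apply: rows_in_col_mx; apply: cK => //; exact: const_stdsimplex.
by apply: on_abound (on_gen KM) => N i; exact: rows_in_row'.
Qed.

Definition mesh_le (n m : nat) (d : R) (M : 'M[R]_(n, m)) : Prop :=
  forall i j, `|row i M - row j M| <= d.

Lemma ball_convex_set m (b : 'rV[R]_m.+1) (d : R) :
  convex_set [set x : 'rV[R]_m.+1 | `|b - x| <= d].
Proof.
move=> n M p [p0 p1] bM /=.
have -> : b - p *m M = \sum_i p 0 i *: (b - row i M).
  rewrite mulmx_sum_row; under [RHS]eq_bigr => i _ do rewrite scalerBr.
  by rewrite sumrB -scaler_suml p1 scale1r.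
apply: le_trans (ler_norm_sum _ _ _) _.
rewrite -[leRHS]mul1r -p1 mulr_suml; apply: ler_sum => i _.
rewrite normrZ ger0_norm; last exact: p0.
by apply: ler_wpM2l; [exact: p0|exact: bM].
Qed.

(** Among the [n.+1] differences averaged by the barycenter the one with [i = j] vanishes, which
    leaves the factor [n / n.+1 < 1]. *)
Lemma barycenter_dist n m (M : 'M[R]_(n.+1, m.+1)) d j : mesh_le d M ->
  `|barycenter M - row j M| <= n%:R / n.+1%:R * d.
Proof.
move=> dM.
have -> : barycenter M - row j M = \sum_(i | i != j) n.+1%:R^-1 *: (row i M - row j M).
  transitivity (\sum_i n.+1%:R^-1 *: (row i M - row j M)).
    rewrite /barycenter mulmx_sum_row.
    under [RHS]eq_bigr => i _ do rewrite scalerBr.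
    under [X in X - _ = _]eq_bigr => i _ do rewrite mxE.
    rewrite sumrB; congr (_ - _); rewrite sumr_const card_ord -scaler_nat scalerA.
    by rewrite divff ?scale1r // pnatr_eq0.
  by rewrite (bigD1 j) //= subrr scaler0 add0r.
apply: le_trans (ler_norm_sum _ _ _) _.
apply: le_trans (_ : \sum_(i | i != j) n.+1%:R^-1 * d <= _).
  apply: ler_sum => i _; rewrite normrZ ger0_norm ?invr_ge0 //.
  by rewrite ler_wpM2l ?invr_ge0.
rewrite sumr_const cardC1 card_ord -[leLHS]mulr_natl mulrA //.
Qed.

(** An edge of the subdivision either lies in the subdivided boundary, where induction applies, or
    joins the barycenter to a point of the convex hull, which stays in the ball around the
    barycenter containing all vertices. The factor is that of a fixed dimension [N], the same for
    all faces, so that the induction on [n] closes. *)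
Lemma on_subdivision_mesh N n m d (c : affine n m.+1) : (n <= N.+1)%N ->
  on (mesh_le d) c -> on (mesh_le (N%:R / N.+1%:R * d)) (subdivision c).
Proof.
elim: n c => [|n IH] c nN; first by move=> _ M _ [].
apply: on_fglift => M dM.
have d0 : 0 <= d by apply: le_trans (normr_ge0 _) (dM ord0 ord0).
set k := _ * d; set b := barycenter M.
have bM : rows_in [set x : 'rV[R]_m.+1 | `|b - x| <= k] M.
  move=> i /=; apply: le_trans (barycenter_dist i dM) _.
  apply: ler_wpM2r => //.
  rewrite ler_pdivrMr // mulrAC ler_pdivlMr // -!natrM ler_nat.
  by rewrite !mulnS; lia.
have k0 : 0 <= k by rewrite /k mulr_ge0 // divr_ge0.
have kon : on (mesh_le k) (subdivision (abound (gen M))).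
  apply: IH; first exact: ltnW.
  apply: on_abound (on_gen dM) => L i dL p q.
  suff E s : row s (row' i L) = row (lift i s) L by rewrite !E.
  by apply/rowP => t; rewrite !mxE.
have bon : on (rows_in [set x : 'rV[R]_m.+1 | `|b - x| <= k])
    (subdivision (abound (gen M))).
  apply: on_subdivision; first exact: ball_convex_set.
  by apply: on_abound (on_gen bM) => L i; exact: rows_in_row'.
apply: on_cone (onI kon bon) => L [kL bL] i j.
have E0 : row ord0 (col_mx b L : 'M_(n.+1, m.+1)) = b.
  by apply/rowP => t; rewrite mxE col_mx_ord0.
have ES s : row (lift ord0 s) (col_mx b L : 'M_(n.+1, m.+1)) = row s L.
  by apply/rowP => t; rewrite mxE col_mx_lift0 mxE.
case: (unliftP ord0 i) => [i'|] ->; case: (unliftP ord0 j) => [j'|] ->.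
- by rewrite !ES.
- by rewrite ES E0 distrC; exact: bL.
- by rewrite ES E0; exact: bL.
- by rewrite subrr normr0.
Qed.

(* The cone construction turns a natural chain map [phi] that vanishes on the
   empty simplex into the boundary of an operator raising the degree; [ex] is
   the dimension of the convex set over which the target chains live. *)
Section ConeHomotopy.
Variables (ex : nat -> nat).
Variable phi : forall n m, {additive affine n m -> affine n (ex m)}.
Variable base : forall n m, 'M[R]_(n.+1, m) -> 'rV[R]_(ex m).

Fixpoint cone_homotopy (n m : nat) : affine n m -> affine n.+1 (ex m) :=
  match n with
  | 0 => fun=> 0
  | n'.+1 => fglift (fun M : 'M_(n'.+1, m) =>
      cone (base M) (phi _ _ (gen M) - cone_homotopy (abound (gen M))))
  end.

Lemma cone_homotopy_is_additive n m : zmod_morphism (@cone_homotopy n m).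
Proof. by case: n => [|n] /= x y; rewrite ?raddfB ?subr0. Qed.

HB.instance Definition _ n m :=
  GRing.isZmodMorphism.Build _ _ _ (@cone_homotopy_is_additive n m).

Arguments cone_homotopy : simpl never.

Lemma cone_homotopy_gen (n m : nat) (M : 'M_(n.+1, m)) :
  cone_homotopy (gen M) =
  cone (base M) (phi _ _ (gen M) - cone_homotopy (abound (gen M))).
Proof. exact: fglift_gen. Qed.

Lemma cone_homotopy0 (m : nat) (c : affine 0 m) : cone_homotopy c = 0.
Proof. by []. Qed.

Hypothesis phi0 : forall m (c : affine 0 m), phi 0 m c = 0.
Hypothesis phi_abound : forall n m (c : affine n.+1 m),
  abound (phi _ _ c) = phi _ _ (abound c).

(** By induction [phi M - cone_homotopy (abound M)] is a cycle, and the cone over a cycle has that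
    cycle as its boundary. In the lowest degree this uses that [phi] vanishes on the empty
    simplex. *)
Lemma abound_cone_homotopy (n m : nat) (c : affine n.+1 m) :
  abound (cone_homotopy c) = phi _ _ c - cone_homotopy (abound c).
Proof.
elim: n c => [|n IH] c.
  apply: (additive_eq (f := @abound 1 _ \o @cone_homotopy 1 m)
    (g := phi 1 m \- (@cone_homotopy 0 m \o @abound 0 m))) => M /=.
  rewrite cone_homotopy_gen abound_cone !cone_homotopy0 subr0 phi_abound phi0.
  by rewrite raddf0 subr0.
apply: (additive_eq (f := @abound n.+2 _ \o @cone_homotopy n.+2 m)
  (g := phi n.+2 m \- (@cone_homotopy n.+1 m \o @abound n.+1 m))) => M /=.
rewrite cone_homotopy_gen abound_cone raddfB /= IH abound_abound raddf0 subr0.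
by rewrite phi_abound subrr raddf0 subr0.
Qed.

Variable exmx : forall m k, 'M[R]_(m, k) -> 'M[R]_(ex m, ex k).
Hypothesis phi_amulmx : forall n m k (N : 'M_(m, k)) (c : affine n m),
  amulmx (exmx N) (phi _ _ c) = phi _ _ (amulmx N c).
Hypothesis base_mulmx : forall n m k (N : 'M_(m, k)) (M : 'M_(n.+1, m)),
  base M *m exmx N = base (M *m N).

Lemma amulmx_cone_homotopy n m k (N : 'M_(m, k)) (c : affine n m) :
  amulmx (exmx N) (cone_homotopy c) = cone_homotopy (amulmx N c).
Proof.
elim: n c => [c|n IH c]; first by rewrite raddf0.
apply: (additive_eq (f := amulmx (exmx N) \o @cone_homotopy n.+1 m)
  (g := @cone_homotopy n.+1 k \o amulmx N)) => M /=.
rewrite cone_homotopy_gen amulmx_cone raddfB /= phi_amulmx IH amulmx_abound.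
by rewrite base_mulmx amulmx_gen cone_homotopy_gen.
Qed.

Lemma on_cone_homotopy n m (K : set 'rV[R]_m) (L : set 'rV[R]_(ex m))
    (c : affine n m) :
  (forall n (c : affine n m), on (rows_in K) c -> on (rows_in L) (phi _ _ c)) ->
  (forall n (M : 'M_(n.+1, m)), rows_in K M -> L (base M)) ->
  on (rows_in K) c -> on (rows_in L) (cone_homotopy c).
Proof.
move=> phiKL baseKL; elim: n c => [|n IH] c; first by move=> _; exact: on0.
apply: on_fglift => M KM.
apply: (@on_cone _ _ (rows_in L)) => [M' LM'|].
  by apply: rows_in_col_mx LM'; exact: baseKL.
apply: onB; first by apply: phiKL; exact: on_gen.
apply: IH; apply: on_abound (on_gen KM) => M' i; exact: rows_in_row'.
Qed.

End ConeHomotopy.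

End AffineChains.

(** * Singular chains *)

Lemma set_val_SigSub (T : Type) (A : set T) (x : T) (Ax : x \in A) :
  set_val (SigSub Ax : A) = x.
Proof. by rewrite set_valE. Qed.

Lemma continuous_set_type (T X : topologicalType) (A : set X) (f : T -> A) :
  continuous (set_val \o f) -> continuous f.
Proof. exact: continuous_comp_initial. Qed.

Lemma continuous_set_val (X : topologicalType) (A : set X) :
  continuous (set_val : A -> X).
Proof. exact: initial_continuous. Qed.

Lemma cvg_matrix (R : realType) (T : topologicalType) (m n : nat)
    (f : T -> 'M[R]_(m, n)) (t : T) :
  (forall i j, f x i j @[x --> t] --> f t i j) -> f x @[x --> t] --> f t.
Proof.
move=> cf A [P ftP sPA]; rewrite nbhs_simpl.
have : \forall x \near t, forall i j, P i j (f x i j).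
  apply: (@filter_forall _ _ (fun i x => forall j, P i j (f x i j))) => i.
  apply: (@filter_forall _ _ (fun j x => P i j (f x i j))) => j.
  exact: cf (ftP i j).
by apply: filterS => x Px; exact: sPA.
Qed.

Lemma continuous_entry (R : realType) (T : topologicalType) (m n : nat)
    (f : T -> 'M[R]_(m, n)) i j : continuous f -> continuous (fun x => f x i j).
Proof.
move=> cf x; apply: (@continuous_comp _ _ _ f (fun M => M i j)); first exact: cf.
exact: coord_continuous.
Qed.

Lemma continuous_matrix (R : realType) (T : topologicalType) (m n : nat)
    (f : T -> 'M[R]_(m, n)) :
  (forall i j, continuous (fun x => f x i j)) -> continuous f.
Proof. by move=> cf x; apply: cvg_matrix => i j; exact: cf. Qed.

Lemma continuous_sum (R : realType) (T : topologicalType) (I : Type)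
    (r : seq I) (F : I -> T -> R) :
  (forall i, continuous (F i)) -> continuous (fun x => \sum_(i <- r) F i x).
Proof.
move=> cF x; elim: r => [|i r IH].
  rewrite (_ : (fun y => _) = cst 0); first exact: cvg_cst.
  by apply/funext => y; rewrite big_nil.
rewrite (_ : (fun y => _) = F i \+ (fun y => \sum_(j <- r) F j y)).
  by apply: continuousD => //; exact: cF.
by apply/funext => y; rewrite big_cons.
Qed.

Lemma continuous_mulmx (R : realType) (T : topologicalType) (m n : nat)
    (f : T -> 'rV[R]_m) (N : 'M[R]_(m, n)) :
  continuous f -> continuous (fun x => f x *m N).
Proof.
move=> cf; apply: continuous_matrix => i j.
under eq_fun => x do rewrite mxE.
apply: continuous_sum => k x; apply: cvgM; last exact: cvg_cst.
exact: (continuous_entry (i := i) (j := k)).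
Qed.

Section SingularChains.
Variable R : realType.

HB.instance Definition _ n X := GRing.isZmodMorphism.Build
  (chain R n.+1 X) (chain R n X) (@boundary R n X) (lift_is_additive _).
HB.instance Definition _ n X Y f := GRing.isZmodMorphism.Build
  (chain R n X) (chain R n Y) (@pushforward R n X Y f) (lift_is_additive _).

Definition simplex_of (X : Type) (n m : nat) (phi : 'rV[R]_m -> X)
    (M : 'M[R]_(n.+1, m)) : stdsimplex R n -> X :=
  fun t => phi (set_val t *m M).

Definition realize (X : topologicalType) (n m : nat) (phi : 'rV[R]_m -> X) :
    affine R n.+1 m -> chain R n X :=
  fglift (fun M => gen (simplex_of phi M)).

HB.instance Definition _ X n m phi := GRing.Additive.on (@realize X n m phi).

Lemma realize_gen (X : topologicalType) n m (phi : 'rV_m -> X) (M : 'M_(n.+1, m)) :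
  realize phi (gen M) = gen (simplex_of phi M).
Proof. exact: fglift_gen. Qed.

Lemma boundary_gen (X : topologicalType) n (sigma : stdsimplex R n.+1 -> X) :
  boundary (gen sigma) = \sum_(i < n.+2) gen (sigma \o face i) *~ ((-1) ^+ i).
Proof. by rewrite [LHS]fglift_gen; apply: eq_bigr => i _; rewrite freegUE. Qed.

Lemma pushforward_gen (X Y : topologicalType) n (f : X -> Y)
    (sigma : stdsimplex R n -> X) :
  pushforward f (gen sigma) = gen (f \o sigma).
Proof. exact: fglift_gen. Qed.

Lemma simplex_of_face (X : Type) n m (phi : 'rV_m -> X) (M : 'M_(n.+2, m)) i :
  simplex_of phi M \o face i = simplex_of phi (row' i M).
Proof.
apply/funext => t; congr (phi _); apply/rowP => j.
rewrite !mxE (bigD1_ord i) //= set_valE /= mxE unlift_none mul0r add0r.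
by apply: eq_bigr => k _; rewrite !mxE liftK set_valE.
Qed.

Lemma boundary_realize (X : topologicalType) n m (phi : 'rV_m -> X)
    (c : affine R n.+2 m) :
  boundary (realize phi c) = realize phi (abound c).
Proof.
apply: (additive_eq (f := @boundary R n X \o @realize X n.+1 m phi)
  (g := @realize X n m phi \o @abound R n.+1 m)) => M /=.
rewrite realize_gen boundary_gen abound_gen raddf_sum; apply: eq_bigr => i _.
by rewrite (raddfMz (realize phi)) /= realize_gen simplex_of_face.
Qed.

Definition center n : stdsimplex R n := SigSub (mem_set (const_stdsimplex R n)).

(* Only the values on the standard simplex matter. *)
Definition extend (X : Type) (n : nat) (sigma : stdsimplex R n -> X) :
    'rV[R]_n.+1 -> X :=
  fun v => sigma (insubd (center n) v).

Lemma extend_val (X : Type) n (sigma : stdsimplex R n -> X) t :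
  extend sigma (set_val t) = sigma t.
Proof. by rewrite /extend set_valE valKd. Qed.

Lemma simplex_of_extend1 (X : Type) n (sigma : stdsimplex R n -> X) :
  simplex_of (extend sigma) 1%:M = sigma.
Proof. by apply/funext => t; rewrite /simplex_of mulmx1 extend_val. Qed.

(** Every singular simplex is the realization of the identity matrix. Rewriting backwards with this
    lemma reduces identities between singular chains to identities between affine ones. *)
Lemma realize_extend1 (X : topologicalType) n (sigma : stdsimplex R n -> X) :
  realize (extend sigma) (gen 1%:M) = gen sigma.
Proof. by rewrite realize_gen simplex_of_extend1. Qed.

Lemma boundary_boundary (X : topologicalType) n (c : chain R n.+2 X) :
  boundary (boundary c) = 0.
Proof.
apply: (additive_eq (f := @boundary R n X \o @boundary R n.+1 X) (g := \0)).
move=> sigma /=; rewrite -realize_extend1 !boundary_realize abound_abound.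
by rewrite raddf0.
Qed.

Lemma pushforward_boundary (X Y : topologicalType) n (f : X -> Y)
    (c : chain R n.+1 X) :
  pushforward f (boundary c) = boundary (pushforward f c).
Proof.
apply: (additive_eq (f := @pushforward R n X Y f \o @boundary R n X)
  (g := @boundary R n Y \o @pushforward R n.+1 X Y f)) => sigma /=.
rewrite pushforward_gen !boundary_gen raddf_sum; apply: eq_bigr => i _.
by rewrite (raddfMz (pushforward f)) /= pushforward_gen.
Qed.

Lemma pushforward_comp (X Y Z : topologicalType) n (f : X -> Y) (g : Y -> Z)
    (c : chain R n X) :
  pushforward g (pushforward f c) = pushforward (g \o f) c.
Proof.
apply: (additive_eq (f := @pushforward R n Y Z g \o @pushforward R n X Y f)
  (g := @pushforward R n X Z (g \o f))) => sigma /=.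
by rewrite !pushforward_gen.
Qed.

Lemma stdsimplex_convex n : convex_set (stdsimplex R n).
Proof.
move=> k M p [p0 p1] MS; split=> [j|].
  rewrite mxE; apply: sumr_ge0 => i _; apply: mulr_ge0; first exact: p0.
  by have [/(_ j)] := MS i; rewrite mxE.
under eq_bigr => j _ do rewrite mxE.
rewrite exchange_big /= -[RHS]p1; apply: eq_bigr => i _.
have [_ Mi1] := MS i; rewrite -mulr_sumr -[RHS]mulr1 -Mi1; congr (_ * _).
by apply: eq_bigr => j _; rewrite mxE.
Qed.

Lemma mul_stdsimplex m n (N : 'M[R]_(m.+1, n.+1)) (t : stdsimplex R m) :
  rows_in (stdsimplex R n) N -> set_val t *m N \in stdsimplex R n.
Proof. by move=> NS; apply/mem_set/stdsimplex_convex => //; exact: set_valP. Qed.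

Lemma simplex_of_extend (X : Type) m n (sigma : stdsimplex R n -> X)
    (N : 'M[R]_(m.+1, n.+1)) (NS : rows_in (stdsimplex R n) N) :
  simplex_of (extend sigma) N =
  sigma \o (fun t => SigSub (mul_stdsimplex t NS)).
Proof.
apply/funext => t; rewrite /simplex_of /= -[RHS]extend_val.
by congr (extend sigma _); rewrite [RHS]set_valE.
Qed.

Lemma simplex_of_extend_comp (X : Type) m n k (phi : 'rV_k -> X)
    (M : 'M[R]_(n.+1, k)) (N : 'M[R]_(m.+1, n.+1)) :
  rows_in (stdsimplex R n) N ->
  simplex_of (extend (simplex_of phi M)) N = simplex_of phi (N *m M).
Proof.
move=> NS; rewrite simplex_of_extend; apply/funext => t.
by rewrite /simplex_of /= mulmxA.
Qed.

(** * Singular chains supported in a subset *)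

Definition simplex_in (X : topologicalType) (U : set X) (n : nat)
    (sigma : stdsimplex R n -> X) : Prop :=
  continuous sigma /\ forall t, U (sigma t).

Definition chain_in (X : topologicalType) (U : set X) (n : nat)
    (c : chain R n X) : Prop :=
  on (simplex_in U (n := n)) c.

Lemma simplex_in_extend (X : topologicalType) (U : set X) m n
    (sigma : stdsimplex R n -> X) (N : 'M[R]_(m.+1, n.+1)) :
  rows_in (stdsimplex R n) N -> simplex_in U sigma ->
  simplex_in U (simplex_of (extend sigma) N).
Proof.
move=> NS [csigma Usigma]; rewrite simplex_of_extend; split=> [|t]; last first.
  exact: Usigma.
move=> t; apply: continuous_comp; last exact: csigma.
apply: continuous_set_type => {}t; apply: continuous_mulmx => s.
exact: continuous_set_val.
Qed.

Lemma rows_in1 n : rows_in (stdsimplex R n) 1%:M.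
Proof.
move=> i; split=> [j|]; first by rewrite !mxE ler0n.
rewrite (bigD1 i) //= big1 ?addr0 => [|j ji]; first by rewrite !mxE eqxx.
by rewrite !mxE eq_sym (negbTE ji).
Qed.

Lemma chain_in_boundary (X : topologicalType) (U : set X) n (c : chain R n.+1 X) :
  chain_in U c -> chain_in U (boundary c).
Proof.
apply: on_fglift => sigma Us; apply: on_sum => i _; rewrite freegUE.
apply: onMz; apply: on_gen; rewrite -[sigma]simplex_of_extend1 simplex_of_face.
by apply: simplex_in_extend Us; apply: rows_in_row'; exact: rows_in1.
Qed.

Lemma chain_inS (X : topologicalType) (U V : set X) n (c : chain R n X) :
  U `<=` V -> chain_in U c -> chain_in V c.
Proof. by move=> UV; apply: sub_on => s [cs Us]; split=> // t; exact: UV. Qed.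

Lemma chain_inI (X : topologicalType) (U V : set X) n (c : chain R n X) :
  chain_in U c -> chain_in V c -> chain_in (U `&` V) c.
Proof.
move=> Uc Vc; apply: sub_on (onI Uc Vc) => s [[cs Us] [_ Vs]].
by split=> // t; split.
Qed.

Lemma singularE (X : topologicalType) n (c : chain R n X) :
  singular c <-> chain_in setT c.
Proof. by split=> [cc s /cc //|cc s /cc []]. Qed.

Lemma chain_in_pushforward (X Y : topologicalType) (U : set X) (V : set Y)
    (f : X -> Y) n (c : chain R n X) :
  (forall s : stdsimplex R n -> X, simplex_in U s -> simplex_in V (f \o s)) ->
  chain_in U c -> chain_in V (pushforward f c).
Proof. by move=> fUV; apply: on_fglift => s /fUV; exact: on_gen. Qed.

Lemma chain_in_continuous (X Y : topologicalType) (f : X -> Y) n (c : chain R n X) :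
  continuous f -> singular c -> singular (pushforward f c).
Proof.
move=> cf /singularE c_in; apply/singularE; apply: chain_in_pushforward c_in.
by move=> s [cs _]; split=> // t; apply: continuous_comp; [exact: cs|exact: cf].
Qed.

(* The singular counterpart of a natural operator [Theta] on affine chains is
   the image of [Theta] on the identity simplex; [Phi] turns maps on a simplex
   into maps on the convex set over which the values of [Theta] live. *)
Section NaturalOperator.
Variables X Y : topologicalType.
Variables (ex : nat -> nat) (exmx : forall m k, 'M[R]_(m, k) -> 'M[R]_(ex m, ex k)).
Variable Phi : forall m, ('rV[R]_m -> X) -> 'rV[R]_(ex m) -> Y.
Variables (n k : nat) (K : set 'rV[R]_(ex n.+1)).
Hypothesis Phi_simplex_of : forall m (phi : 'rV_m -> X) (M : 'M_(n.+1, m))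
  (N : 'M_(k.+1, ex n.+1)), rows_in K N ->
  simplex_of (Phi (extend (simplex_of phi M))) N = simplex_of (Phi phi) (N *m exmx M).
Variable Theta : forall m, {additive affine R n.+1 m -> affine R k.+1 (ex m)}.
Hypothesis Theta_natural : forall m p (N : 'M_(m, p)) c,
  amulmx (exmx N) (Theta m c) = Theta p (amulmx N c).
Hypothesis Theta1 : on (rows_in K) (Theta _ (gen 1%:M)).

Definition natural_op : chain R n X -> chain R k Y :=
  fglift (fun sigma : stdsimplex R n -> X => realize (Phi (extend sigma)) (Theta _ (gen 1%:M))).

HB.instance Definition _ := GRing.Additive.on natural_op.

Lemma natural_op_gen (sigma : stdsimplex R n -> X) :
  natural_op (gen sigma) = realize (Phi (extend sigma)) (Theta _ (gen 1%:M)).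
Proof. exact: fglift_gen. Qed.

(** By naturality [Theta (gen M)] is the image under [exmx M] of the value on the identity simplex.
    The condition [rows_in K] matters because [extend] recovers a map only on the standard
    simplex. *)
Lemma natural_op_realize m (phi : 'rV_m -> X) (c : affine R n.+1 m) :
  natural_op (realize phi c) = realize (Phi phi) (Theta _ c).
Proof.
apply: (additive_eq (f := natural_op \o @realize X n m phi)
  (g := @realize Y k _ (Phi phi) \o Theta m)) => M /=.
rewrite realize_gen natural_op_gen.
have -> : Theta m (gen M) = amulmx (exmx M) (Theta _ (gen 1%:M)).
  by rewrite Theta_natural amulmx_gen mul1mx.
apply: (additive_eq_on (f := @realize Y k _ (Phi (extend (simplex_of phi M))))
  (g := @realize Y k _ (Phi phi) \o @amulmx R _ _ _ (exmx M)) _ Theta1) => N KN /=.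
by rewrite amulmx_gen !realize_gen Phi_simplex_of.
Qed.

Lemma chain_in_natural_op (U : set X) (V : set Y) c :
  (forall (sigma : stdsimplex R n -> X) N, simplex_in U sigma -> rows_in K N ->
     simplex_in V (simplex_of (Phi (extend sigma)) N : stdsimplex R k -> Y)) ->
  chain_in U c -> chain_in V (natural_op c).
Proof.
move=> UV; apply: on_fglift => sigma Us; apply: on_fglift Theta1 => N KN.
by apply: on_gen; exact: UV.
Qed.

End NaturalOperator.

End SingularChains.

(** * Small chains *)

Section SmallChains.
Variable R : realType.

Lemma stdsimplex_compact n : compact (stdsimplex R n).
Proof.
apply: (@subclosed_compact _ _ [set x : 'rV[R]_n.+1 | forall i, `[0, 1]%classic (x ord0 i)]).
- have -> : stdsimplex R n = (\bigcap_i [set x : 'rV_n.+1 | 0 <= x 0 i]) `&`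
      [set x | \sum_i x 0 i = 1].
    apply/seteqP; split=> x [x0 x1]; split=> // i; last exact: x0.
    by move=> _; exact: x0.
  apply: closedI.
    apply: closed_bigI => i _.
    apply: (@preimage_closed _ _ (fun x : 'rV[R]_n.+1 => x 0 i) [set y | 0 <= y]).
      by move=> x _; exact: coord_continuous.
    exact: closed_ge.
  apply: (@preimage_closed _ _ (fun x : 'rV[R]_n.+1 => \sum_i x 0 i) [set y | y = 1]).
    by move=> x _; apply: continuous_sum => i; exact: coord_continuous.
  exact: closed_eq.
- by apply: (@rV_compact R n.+1 (fun=> `[0, 1]%classic)) => i; exact: segment_compact.
- move=> x [x0 x1] i /=; rewrite in_itv /= x0 /= -x1 (bigD1 i) //= lerDl.
  by apply: sumr_ge0 => j _; exact: x0.
Qed.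

(** Compactness in its near-covering form: it is enough that each point has a neighborhood on which
    one radius works for all smaller ones. The center [x] is a plain vector because it will be a row
    of a matrix. *)
Lemma lebesgue_number (X : topologicalType) (U V : set X) n
    (sigma : stdsimplex R n -> X) : open U -> open V ->
  simplex_in (U `|` V) sigma ->
  exists2 e : R, 0 < e & forall x, stdsimplex R n x ->
    (forall t, `|x - set_val t| < e -> U (sigma t)) \/
    (forall t, `|x - set_val t| < e -> V (sigma t)).
Proof.
move=> oU oV [cs UVs].
have loc (W : set X) (s : stdsimplex R n) : open W -> W (sigma s) ->
    exists2 d : R, 0 < d & forall t, `|set_val s - set_val t| < d -> W (sigma t).
  move=> oW Ws; have : nbhs s (sigma @^-1` W).
    by apply: cs; exact: open_nbhs_nbhs.
  move=> /nbhs_ballP[d /= d0 dW]; exists d => // t st; apply: dW.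
  by rewrite -initial_ballE /= mx_norm_ball.
pose P (e : R) (x : 'rV[R]_n.+1) :=
  (forall t, `|x - set_val t| < e -> U (sigma t)) \/
  (forall t, `|x - set_val t| < e -> V (sigma t)).
have SP : \forall e \near 0^'+, stdsimplex R n `<=` P e.
  apply: (iffLR (compact_near_coveringP _) (@stdsimplex_compact n)) => x Sx.
  pose s : stdsimplex R n := SigSub (mem_set Sx).
  have xE : x = set_val s by rewrite set_valE.
  (* Halving the radius leaves room for the triangle inequality when the center moves from [x] to a
     nearby [y]. *)
  have half (W : set X) : open W -> W (sigma s) -> exists2 d : R, 0 < d &
      forall y e, `|x - y| < d -> e < d ->
      forall t, `|y - set_val t| < e -> W (sigma t).
    move=> oW /(loc _ _ oW)[d d0 dW]; exists (d / 2); first by rewrite divr_gt0.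
    move=> y e xy ed t yt; apply: dW; rewrite -xE.
    rewrite (splitr d) -(subrKA y); apply: le_lt_trans (ler_normD _ _) _.
    by apply: ltrD => //; exact: lt_trans yt ed.
  suff [d d0 dP] : exists2 d : R, 0 < d &
      forall y e, `|x - y| < d -> e < d -> P e y.
    exists (ball x d, [set e | e < d]) => /=.
      by split; [exact: nbhsx_ballx|exact: nbhs_right_lt].
    by move=> [y e] /= [xy ed]; apply: dP => //; move: xy; rewrite mx_norm_ball.
  case: (UVs s) => [/(half _ oU)|/(half _ oV)] [d d0 dW]; exists d => // y e xy ed.
    by left; exact: dW.
  by right; exact: dW.
have [e [e0 eP]] := filter_ex (filterI (nbhs_right_gt 0) SP).
by exists e => // x /eP.
Qed.

Definition sd n (X : topologicalType) : chain R n X -> chain R n X :=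
  natural_op (ex := id) (fun m (phi : 'rV[R]_m -> X) => phi)
    (fun m => @subdivision R n.+1 m).

(** The chain map to feed to [cone_homotopy]: it vanishes on the empty simplex, and the resulting
    operator is a homotopy between the identity and subdivision. *)
Definition sd_diff n m : {additive affine R n m -> affine R n m} :=
  idfun \- @subdivision R n m.

Lemma sd_diff0 m (c : affine R 0 m) : sd_diff 0 m c = 0.
Proof. by rewrite /= subrr. Qed.

Lemma abound_sd_diff n m (c : affine R n.+1 m) :
  abound (sd_diff _ _ c) = sd_diff _ _ (abound c).
Proof. by rewrite /= raddfB /= abound_subdivision. Qed.

Lemma amulmx_sd_diff n m k (N : 'M[R]_(m, k)) (c : affine R n m) :
  amulmx N (sd_diff _ _ c) = sd_diff _ _ (amulmx N c).
Proof. by rewrite /= raddfB /= amulmx_subdivision. Qed.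

Lemma barycenter_mulmx n m k (N : 'M[R]_(m, k)) (M : 'M_(n.+1, m)) :
  barycenter M *m N = barycenter (M *m N).
Proof. by rewrite /barycenter mulmxA. Qed.

Definition sd_homotopy n (X : topologicalType) : chain R n X -> chain R n.+1 X :=
  natural_op (ex := id) (fun m (phi : 'rV[R]_m -> X) => phi)
    (fun m => @cone_homotopy R id sd_diff (@barycenter R) n.+1 m).

HB.instance Definition _ n X := GRing.Additive.on (@sd n X).
HB.instance Definition _ n X := GRing.Additive.on (@sd_homotopy n X).

Lemma on_subdivision1 n :
  on (rows_in (stdsimplex R n)) (subdivision (gen (1%:M : 'M[R]_n.+1))).
Proof.
apply: on_subdivision; first exact: stdsimplex_convex.
by apply: on_gen; exact: rows_in1.
Qed.

Lemma on_sd_homotopy1 n : on (rows_in (stdsimplex R n))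
  (cone_homotopy sd_diff (@barycenter R) (gen (1%:M : 'M[R]_n.+1))).
Proof.
apply: (@on_cone_homotopy _ _ _ _ _ _ (stdsimplex R n)).
- move=> k c cS; apply: onB => //; apply: on_subdivision cS.
  exact: stdsimplex_convex.
- move=> k M MS; apply: stdsimplex_convex => //; exact: const_stdsimplex.
- by apply: on_gen; exact: rows_in1.
Qed.

Lemma sd_realize (X : topologicalType) n m (phi : 'rV_m -> X) (c : affine R n.+1 m) :
  sd (realize phi c) = realize phi (subdivision c).
Proof.
apply: (natural_op_realize (exmx := fun _ _ N => N) (K := stdsimplex R n)).
- by move=> k psi M N NS; exact: simplex_of_extend_comp.
- by move=> k p N c'; exact: amulmx_subdivision.
- exact: on_subdivision1.
Qed.

Lemma sd_homotopy_realize (X : topologicalType) n m (phi : 'rV_m -> X)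
    (c : affine R n.+1 m) :
  sd_homotopy (realize phi c) =
  realize phi (cone_homotopy sd_diff (@barycenter R) c).
Proof.
apply: (natural_op_realize (exmx := fun _ _ N => N) (K := stdsimplex R n)).
- by move=> k psi M N NS; exact: simplex_of_extend_comp.
- move=> k p N c'; apply: (amulmx_cone_homotopy (exmx := fun _ _ N => N)).
    exact: amulmx_sd_diff.
  exact: barycenter_mulmx.
- exact: on_sd_homotopy1.
Qed.

Lemma boundary_sd (X : topologicalType) n (c : chain R n.+1 X) :
  boundary (sd c) = sd (boundary c).
Proof.
apply: (additive_eq (f := @boundary R n X \o @sd n.+1 X)
  (g := @sd n X \o @boundary R n X)) => sigma /=.
rewrite -realize_extend1 sd_realize !boundary_realize sd_realize.
by rewrite abound_subdivision.
Qed.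

Lemma boundary_sd_homotopy (X : topologicalType) n (c : chain R n.+1 X) :
  boundary (sd_homotopy c) = c - sd c - sd_homotopy (boundary c).
Proof.
apply: (additive_eq (f := @boundary R n.+1 X \o @sd_homotopy n.+1 X)
  (g := (idfun \- @sd n.+1 X) \- (@sd_homotopy n X \o @boundary R n X))) => sigma /=.
rewrite -realize_extend1 sd_realize !boundary_realize !sd_homotopy_realize.
rewrite boundary_realize (abound_cone_homotopy _ sd_diff0 abound_sd_diff).
by rewrite !raddfB.
Qed.

Lemma chain_in_sd (X : topologicalType) (U : set X) n (c : chain R n X) :
  chain_in U c -> chain_in U (sd c).
Proof.
apply: chain_in_natural_op; first exact: on_subdivision1.
by move=> s N Us NS; exact: simplex_in_extend.
Qed.

Lemma chain_in_sd_homotopy (X : topologicalType) (U : set X) n (c : chain R n X) :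
  chain_in U c -> chain_in U (sd_homotopy c).
Proof.
apply: chain_in_natural_op; first exact: on_sd_homotopy1.
by move=> s N Us NS; exact: simplex_in_extend.
Qed.

(** * Chains small for a cover by two open sets *)

Section Cover.
Variables (X : topologicalType) (U V : set X).
Hypotheses (oU : open U) (oV : open V).

Definition small n (c : chain R n X) : Prop :=
  exists a b, [/\ c = a + b, chain_in U a & chain_in V b].

Lemma smallB n (c1 c2 : chain R n X) : small c1 -> small c2 -> small (c1 - c2).
Proof.
move=> [a1 [b1 [-> Ua1 Vb1]]] [a2 [b2 [-> Ua2 Vb2]]].
exists (a1 - a2), (b1 - b2).
by split; [rewrite opprD addrACA|exact: onB|exact: onB].
Qed.

Lemma small0 n : small (0 : chain R n X).
Proof. by exists 0, 0; split; [rewrite addr0|exact: on0|exact: on0]. Qed.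

Lemma smallD n (c1 c2 : chain R n X) : small c1 -> small c2 -> small (c1 + c2).
Proof.
move=> s1 s2; rewrite -[c2]opprK -[- c2]sub0r.
exact: smallB s1 (smallB (small0 n) s2).
Qed.

Lemma small_sd n (c : chain R n X) : small c -> small (sd c).
Proof.
move=> [a [b [-> Ua Vb]]]; exists (sd a), (sd b).
by split; [rewrite raddfD|exact: chain_in_sd|exact: chain_in_sd].
Qed.

Lemma small_sd_homotopy n (c : chain R n X) : small c -> small (sd_homotopy c).
Proof.
move=> [a [b [-> Ua Vb]]]; exists (sd_homotopy a), (sd_homotopy b).
by split; [rewrite raddfD|exact: chain_in_sd_homotopy|exact: chain_in_sd_homotopy].
Qed.

Lemma small_iter_sd n (c : chain R n X) k : small c -> small (iter k (@sd n X) c).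
Proof. by move=> sc; elim: k => //= k IH; exact: small_sd. Qed.

Lemma iter_sd_realize n m (phi : 'rV_m -> X) (c : affine R n.+1 m) k :
  iter k (@sd n X) (realize phi c) = realize phi (iter k (@subdivision R n.+1 m) c).
Proof. by elim: k => //= k ->; rewrite sd_realize. Qed.

Lemma on_iter_subdivision n m (K : set 'rV[R]_m.+1) d k (c : affine R n.+1 m.+1) :
  convex_set K -> on (rows_in K) c -> on (mesh_le d) c ->
  on (fun M => rows_in K M /\ mesh_le ((n%:R / n.+1%:R) ^+ k * d) M)
    (iter k (@subdivision R n.+1 m.+1) c).
Proof.
move=> cK Kc dc; elim: k => [|k IH] /=; first by rewrite mul1r; exact: onI.
apply: onI.
  by apply: on_subdivision => //; apply: sub_on IH => M [].
by rewrite exprS -mulrA; apply: on_subdivision_mesh => //; apply: sub_on IH => M [].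
Qed.

Lemma mesh_le_ex n m (M : 'M[R]_(n, m.+1)) : exists2 d : R, 0 <= d & mesh_le d M.
Proof.
exists (\sum_i \sum_j `|row i M - row j M|).
  by apply: sumr_ge0 => i _; apply: sumr_ge0.
move=> i j; rewrite (bigD1 i) //= (bigD1 j) //= -addrA lerDl addr_ge0 //.
  by apply: sumr_ge0.
by apply: sumr_ge0 => k _; apply: sumr_ge0.
Qed.

Lemma iter_sd_small n (c : chain R n X) : chain_in (U `|` V) c ->
  exists k, small (iter k (@sd n X) c).
Proof.
elim/on_ind => [|c1 c2 [k1 s1] [k2 s2]|sigma UVs].
- by exists 0%N; exact: small0.
(* Further subdivision keeps a chain small, so the two counts can be added. *)
- exists (k1 + k2)%N.
  have iterB k (a b : chain R n X) :
      iter k (@sd n X) (a - b) = iter k (@sd n X) a - iter k (@sd n X) b.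
    by elim: k => //= k ->; rewrite raddfB.
  rewrite iterB; apply: smallB; last by rewrite iterD; exact: small_iter_sd.
  by rewrite addnC iterD; exact: small_iter_sd.
have [e e0 eUV] := lebesgue_number oU oV UVs.
have [d d0 d1] := mesh_le_ex (1%:M : 'M[R]_n.+1).
have [k kd] : exists k, (n%:R / n.+1%:R) ^+ k * d < e.
  have /cvg_expr : `|n%:R / n.+1%:R : R| < 1.
    by rewrite ger0_norm ?divr_ge0 // ltr_pdivrMr // mul1r ltr_nat.
  (* The denominator is [d + 1] because the mesh bound [d] may be 0. *)
  move=> /cvgrPdist_lt /(_ (e / (d + 1))).
  have d10 : 0 < d + 1 by rewrite ltr_wpDl.
  rewrite divr_gt0 // => /(_ isT) /filter_ex [k /=]; rewrite sub0r normrN.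
  move=> kd; exists k; apply: le_lt_trans (_ : _ <= _ * (d + 1)) _; last first.
    by rewrite -ltr_pdivlMr //; apply: le_lt_trans kd; exact: ler_norm.
  by rewrite ler_wpM2l ?lerDl // exprn_ge0 // divr_ge0.
exists k; rewrite -realize_extend1 iter_sd_realize.
apply: on_split; apply: on_fglift; last first.
  apply: (on_iter_subdivision (K := stdsimplex R n)).
  - exact: stdsimplex_convex.
  - by apply: on_gen; exact: rows_in1.
  - by apply: on_gen; exact: d1.
move=> M [MS dM]; apply: on_gen.
have [cs _] := simplex_in_extend MS UVs.
(* All of a small affine simplex is within [e] of its first vertex, so the Lebesgue number applied
   at that vertex places the whole simplex in one of the two sets. *)
have tM (t : stdsimplex R n) : `|row ord0 M - set_val t *m M| < e.
  apply: le_lt_trans kd.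
  have := @ball_convex_set R n (row ord0 M) ((n%:R / n.+1%:R) ^+ k * d) n M _
    (set_valP t).
  by apply=> i; exact: dM.
have sE t : simplex_of (extend sigma) M t = sigma (SigSub (mul_stdsimplex t MS)).
  by rewrite simplex_of_extend.
case: (eUV (row ord0 M) (MS _)) => W; [left|right].
  by split=> // t; rewrite sE; apply: W; rewrite set_val_SigSub; exact: tM.
by split=> // t; rewrite sE; apply: W; rewrite set_val_SigSub; exact: tM.
Qed.

(** With [T] the subdivision homotopy, [c = sd c + T (boundary c) + boundary (T c)], and the middle
    term is small because [boundary c] is. Assuming only a small boundary, not a cycle, is what the
    freeness half of Mayer-Vietoris requires. *)
Lemma small_chains n (c : chain R n.+1 X) :
  chain_in (U `|` V) c -> small (boundary c) ->
  exists c' h, [/\ small c', chain_in (U `|` V) h & c = c' + boundary h].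
Proof.
move=> UVc; have [k] := iter_sd_small UVc.
elim: k c UVc => [|k IH] c UVc kc sbc.
  by exists c, 0; split=> //; [exact: on0|rewrite raddf0 addr0].
have [|||c' [h [sc' UVh sdE]]] := IH (sd c).
- exact: chain_in_sd.
- by rewrite -iterSr.
- by rewrite boundary_sd; exact: small_sd.
exists (c' + sd_homotopy (boundary c)), (h + sd_homotopy c); split.
- by apply: smallD => //; exact: small_sd_homotopy.
- by apply: onD => //; exact: chain_in_sd_homotopy.
rewrite raddfD /= boundary_sd_homotopy sdE.
by rewrite addrACA [in RHS](addrC (sd_homotopy _)) subrK addrC subrK.
Qed.

End Cover.

End SmallChains.

(** * Homotopy invariance *)

Section Homotopy.
Variable R : realType.

Lemma row_lsubmx n p q (N : 'M[R]_(n, p + q)) i :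
  row i (lsubmx N) = lsubmx (row i N).
Proof. by apply/rowP => j; rewrite !mxE. Qed.

(** Top minus bottom of the cylinder, time being the last coordinate. On the empty simplex both ends
    coincide, so the cone construction applies and produces the prism operator. *)
Definition cylinder_ends n m (c : affine R n m) : affine R n (m + 1) :=
  fglift (fun M : 'M_(n, m) =>
    gen (row_mx M (const_mx 1)) - gen (row_mx M (const_mx 0))) c.

HB.instance Definition _ n m := GRing.isZmodMorphism.Build
  (affine R n m) (affine R n (m + 1)) (@cylinder_ends n m) (lift_is_additive _).

Lemma cylinder_ends_gen n m (M : 'M_(n, m)) : cylinder_ends (gen M) =
  gen (row_mx M (const_mx 1)) - gen (row_mx M (const_mx 0)).
Proof. exact: fglift_gen. Qed.

Lemma cylinder_ends0 m (c : affine R 0 m) : cylinder_ends c = 0.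
Proof.
apply: (additive_eq (f := @cylinder_ends 0 m) (g := \0)) => M /=.
by rewrite cylinder_ends_gen [row_mx _ _]flatmx0 [X in _ - gen X]flatmx0 subrr.
Qed.

Lemma abound_cylinder_ends n m (c : affine R n.+1 m) :
  abound (cylinder_ends c) = cylinder_ends (abound c).
Proof.
apply: (additive_eq (f := @abound R n _ \o @cylinder_ends n.+1 m)
  (g := @cylinder_ends n m \o @abound R n m)) => M /=.
rewrite cylinder_ends_gen raddfB /= !abound_gen -sumrB raddf_sum.
apply: eq_bigr => i _; rewrite (raddfMz (@cylinder_ends n m)) /=.
rewrite cylinder_ends_gen mulrzBl; congr (gen _ *~ _ - gen _ *~ _).
  by apply/matrixP => p j; rewrite !mxE; case: splitP => q _; rewrite !mxE.
by apply/matrixP => p j; rewrite !mxE; case: splitP => q _; rewrite !mxE.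
Qed.

Definition cylinder_mx m k (N : 'M[R]_(m, k)) : 'M[R]_(m + 1, k + 1) :=
  block_mx N 0 0 1%:M.

Lemma row_mx_cylinder_mx n m k (M : 'M[R]_(n, m)) (v : 'M[R]_(n, 1)) (N : 'M_(m, k)) :
  row_mx M v *m cylinder_mx N = row_mx (M *m N) v.
Proof. by rewrite mul_row_block !mulmx0 mulmx1 addr0 add0r. Qed.

Lemma amulmx_cylinder_ends n m k (N : 'M_(m, k)) (c : affine R n m) :
  amulmx (cylinder_mx N) (cylinder_ends c) = cylinder_ends (amulmx N c).
Proof.
apply: (additive_eq (f := amulmx (cylinder_mx N) \o @cylinder_ends n m)
  (g := @cylinder_ends n k \o amulmx N)) => M /=.
rewrite cylinder_ends_gen raddfB /= !amulmx_gen cylinder_ends_gen.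
by rewrite !row_mx_cylinder_mx.
Qed.

(** The first vertex at time 0 serves as apex: it depends linearly on [M], as naturality demands,
    and lies in the cylinder. *)
Definition cylinder_base n m (M : 'M[R]_(n.+1, m)) : 'rV[R]_(m + 1) :=
  row_mx (row ord0 M) 0.

Lemma cylinder_base_mulmx n m k (N : 'M[R]_(m, k)) (M : 'M_(n.+1, m)) :
  cylinder_base M *m cylinder_mx N = cylinder_base (M *m N).
Proof. by rewrite /cylinder_base row_mx_cylinder_mx row_mul. Qed.

Definition cylinder n : set 'rV[R]_(n.+1 + 1) :=
  [set w | stdsimplex R n (lsubmx w) /\ 0 <= rsubmx w 0 0 <= 1].

Definition prism n m : affine R n m -> affine R n.+1 (m + 1) :=
  @cone_homotopy R (fun k => k + 1)%N cylinder_ends cylinder_base n m.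

HB.instance Definition _ n m := GRing.Additive.on (@prism n m).

Lemma on_prism1 n :
  on (rows_in (@cylinder n)) (prism (gen (1%:M : 'M[R]_n.+1))).
Proof.
have cyl k (M : 'M[R]_(k, n.+1)) (a : R) : 0 <= a <= 1 ->
    rows_in (stdsimplex R n) M -> rows_in (@cylinder n) (row_mx M (const_mx a)).
  move=> a01 MS i; split; first by rewrite row_row_mx row_mxKl.
  by rewrite row_row_mx row_mxKr !mxE.
apply: (@on_cone_homotopy _ _ _ _ _ _ (stdsimplex R n)).
- move=> k c; apply: on_fglift => M MS.
  by apply: onB; apply: on_gen; apply: cyl; rewrite // ?lexx ler01.
- move=> k M MS; split; first by rewrite /cylinder_base row_mxKl.
  by rewrite row_mxKr mxE lexx ler01.
- by apply: on_gen; exact: rows_in1.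
Qed.

Section Operator.
Variables (X Y : topologicalType) (H : X -> R -> Y).

Definition on_cylinder m (phi : 'rV[R]_m -> X) : 'rV[R]_(m + 1) -> Y :=
  fun w => H (phi (lsubmx w)) (rsubmx w 0 0).

Definition homotopy_op n : chain R n X -> chain R n.+1 Y :=
  natural_op (ex := fun m => (m + 1)%N) (on_cylinder) (fun m => @prism n.+1 m).

HB.instance Definition _ n := GRing.Additive.on (@homotopy_op n).

Lemma homotopy_op_realize n m (phi : 'rV_m -> X) (c : affine R n.+1 m) :
  homotopy_op (realize phi c) = realize (on_cylinder phi) (prism c).
Proof.
apply: (natural_op_realize (exmx := cylinder_mx) (K := @cylinder n)).
- move=> k psi M N NC; apply/funext => t; rewrite /simplex_of /on_cylinder.
  rewrite mulmxA -[set_val t *m N]hsubmxK row_mx_cylinder_mx !row_mxKl !row_mxKr.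
  have tl : set_val t *m lsubmx N \in stdsimplex R n.
    apply: mul_stdsimplex => i.
    by rewrite row_lsubmx; have [] := NC i.
  have -> : lsubmx (set_val t *m N) = set_val (SigSub tl : stdsimplex R n).
    by rewrite set_val_SigSub mulmx_lsub.
  by rewrite extend_val.
- move=> k p N c'; apply: (amulmx_cone_homotopy (exmx := cylinder_mx)).
    exact: amulmx_cylinder_ends.
  exact: cylinder_base_mulmx.
- exact: on_prism1.
Qed.

Lemma realize_cylinder_ends n m (phi : 'rV_m -> X) (c : affine R n.+1 m) :
  realize (on_cylinder phi) (cylinder_ends c) =
  pushforward (H^~ 1) (realize phi c) - pushforward (H^~ 0) (realize phi c).
Proof.
apply: (additive_eq (f := realize (on_cylinder phi) \o @cylinder_ends n.+1 m)
  (g := (@pushforward R n X Y (H^~ 1) \o realize phi) \-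
        (@pushforward R n X Y (H^~ 0) \o realize phi))) => M /=.
rewrite cylinder_ends_gen raddfB /= !realize_gen !pushforward_gen.
congr (gen _ - gen _); apply/funext => t; rewrite /simplex_of /on_cylinder /=;
  rewrite mul_mx_row row_mxKl row_mxKr; congr (H _ _).
  have [_ t1] := set_valP t.
  by rewrite mxE -[RHS]t1; apply: eq_bigr => i _; rewrite mxE mulr1.
by rewrite mxE big1 // => i _; rewrite mxE mulr0.
Qed.

Lemma boundary_homotopy_op n (c : chain R n.+1 X) :
  boundary (homotopy_op c) =
  pushforward (H^~ 1) c - pushforward (H^~ 0) c - homotopy_op (boundary c).
Proof.
apply: (additive_eq (f := @boundary R n.+1 Y \o @homotopy_op n.+1)
  (g := (@pushforward R n.+1 X Y (H^~ 1) \- @pushforward R n.+1 X Y (H^~ 0)) \-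
        (@homotopy_op n \o @boundary R n X))) => sigma /=.
rewrite -realize_extend1 -realize_cylinder_ends boundary_realize.
rewrite !homotopy_op_realize boundary_realize.
rewrite (abound_cone_homotopy _ cylinder_ends0 abound_cylinder_ends).
by rewrite raddfB.
Qed.

(** Singular chains have no degree below 0. In the augmented affine complex the missing term is the
    prism over the empty simplex, which is 0. *)
Lemma boundary_homotopy_op0 (c : chain R 0 X) :
  boundary (homotopy_op c) = pushforward (H^~ 1) c - pushforward (H^~ 0) c.
Proof.
apply: (additive_eq (f := @boundary R 0 Y \o @homotopy_op 0)
  (g := (@pushforward R 0 X Y (H^~ 1) \- @pushforward R 0 X Y (H^~ 0)))) => sigma /=.
rewrite -realize_extend1 -realize_cylinder_ends homotopy_op_realize.
rewrite boundary_realize (abound_cone_homotopy _ cylinder_ends0 abound_cylinder_ends).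
by rewrite raddfB /= raddf0 subr0.
Qed.

Variables (U : set X) (V : set Y).
(** Continuity is asked only along simplices in [U] and for times in the unit interval: [H] may be
    discontinuous off [U], as with [normalize] at the origin, and may leave [V] at other times. *)
Hypothesis HUV : forall n (sigma : stdsimplex R n -> X) (h : stdsimplex R n -> R),
  simplex_in U sigma -> continuous h -> (forall t, 0 <= h t <= 1) ->
  simplex_in V (fun t => H (sigma t) (h t)).

Lemma chain_in_homotopy_op n (c : chain R n X) :
  chain_in U c -> chain_in V (homotopy_op c).
Proof.
apply: chain_in_natural_op; first exact: on_prism1.
move=> sigma N Us NC.
have NS : rows_in (stdsimplex R n) (lsubmx N).
  by move=> i; rewrite row_lsubmx; have [] := NC i.
pose s := simplex_of (extend sigma) (lsubmx N).
pose h (t : stdsimplex R n.+1) := (set_val t *m rsubmx N) 0 0.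
have -> : simplex_of (on_cylinder (extend sigma)) N = fun t => H (s t) (h t).
  apply/funext => t; rewrite /s /h /simplex_of /on_cylinder.
  by rewrite mulmx_lsub mulmx_rsub.
apply: HUV; first exact: simplex_in_extend.
  apply: continuous_entry; apply: continuous_mulmx; exact: continuous_set_val.
move=> t; have [t0 t1] := set_valP t.
have N01 i : 0 <= rsubmx N i 0 <= 1.
  by have [_] := NC i; rewrite !mxE.
apply/andP; rewrite /h mxE; split.
  apply: sumr_ge0 => i _; apply: mulr_ge0; first exact: t0.
  by have /andP[] := N01 i.
rewrite -[leRHS]t1; apply: ler_sum => i _; apply: ler_piMr; first exact: t0.
by have /andP[] := N01 i.
Qed.

Lemma homotopy_invariance n (c : chain R n X) : chain_in U c -> is_cycle c ->
  exists2 b, chain_in V b &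
    pushforward (H^~ 1) c - pushforward (H^~ 0) c = boundary b.
Proof.
move=> Uc zc; exists (homotopy_op c); first exact: chain_in_homotopy_op.
case: n c Uc zc => [|n] c _ /= zc; first by rewrite boundary_homotopy_op0.
by rewrite boundary_homotopy_op zc raddf0 subr0.
Qed.

End Operator.
End Homotopy.

(** * Mayer-Vietoris *)

Section ReducedHomology.
Variable R : realType.

Section Definitions.
Variable X : topologicalType.

(** [deg] is the augmentation. Reduced homology lets the induction start at a space with two
    contractible components, whose reduced group in degree 0 is infinite cyclic. *)
Definition reduced_cycle n (c : chain R n X) : Prop :=
  is_cycle c /\ (n = 0%N -> deg c = 0).

Definition acyclic n (U : set X) : Prop :=
  forall c : chain R n X, chain_in U c -> reduced_cycle c ->
  exists2 b, chain_in U b & c = boundary b.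

(** The reduced homology of [U] in degree [n] is infinite cyclic on the class of [z]. Chains remain
    chains of [X], so those of [U], [V], their union and their intersection share one type. *)
Definition freely_generates n (U : set X) (z : chain R n X) : Prop :=
  [/\ reduced_cycle z, chain_in U z,
    forall c, chain_in U c -> reduced_cycle c ->
      exists m b, chain_in U b /\ c = z *~ m + boundary b &
    forall m b, chain_in U b -> z *~ m = boundary b -> m = 0].

Lemma deg_boundary (c : chain R 1 X) : deg (boundary c) = 0.
Proof.
apply: (additive_eq (f := @deg _ \o @boundary R 0 X) (g := \0)) => s /=.
rewrite boundary_gen !big_ord_recl big_ord0 addr0 raddfD /= !raddfMz /= !deg_gen.
by [].
Qed.

Lemma reduced_cycle_boundary n (c : chain R n.+1 X) : reduced_cycle (boundary c).
Proof.
split; first by case: n c => // n c; exact: boundary_boundary.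
by case: n c => // c _; exact: deg_boundary.
Qed.

Lemma reduced_cycle_succ n (c : chain R n.+1 X) : boundary c = 0 -> reduced_cycle c.
Proof. by []. Qed.

Definition constant_simplex n (e : X) : stdsimplex R n -> X := fun=> e.

Lemma chain_in_constant n (U : set X) e : U e -> chain_in U (gen (@constant_simplex n e)).
Proof. by move=> Ue; apply: on_gen; split=> t; [exact: (@cst_continuous _ _ e)|exact: Ue]. Qed.

Lemma alternating_sum n : \sum_(i < n) (-1) ^+ i = (odd n)%:R :> int.
Proof.
elim: n => [|n IH]; first by rewrite big_ord0.
rewrite big_ord_recr /= IH -signr_odd.
by case: (odd n); rewrite ?expr0 ?expr1 ?add0r ?subrr.
Qed.

(** All [n.+2] faces coincide, so only the alternating sum of their signs remains. *)
Lemma boundary_constant n e :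
  boundary (gen (@constant_simplex n.+1 e)) = gen (@constant_simplex n e) *~ odd n.
Proof.
rewrite boundary_gen.
under eq_bigr => i _ do rewrite (_ : _ \o _ = constant_simplex e) //.
by rewrite -mulrz_sumr alternating_sum /= negbK; case: (odd n).
Qed.

(** For odd [n] the constant simplex is itself a boundary. For even [n] the hypothesis forces
    [m = 0], through the augmentation when [n = 0] and through the nonzero boundary otherwise. So
    [k = m] always works. *)
Lemma constant_bounds n e m : reduced_cycle (gen (@constant_simplex n e) *~ m) ->
  exists k, gen (@constant_simplex n e) *~ m =
            boundary (gen (@constant_simplex n.+1 e) *~ k).
Proof.
move=> [zc dc]; exists m; rewrite raddfMz /= boundary_constant.
case: n zc dc => [_|n zc _] /=.
  by move=> /(_ erefl); rewrite raddfMz /= deg_gen intz => ->.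
have := zc; rewrite /= raddfMz /= boundary_constant.
case: (odd n) => /= [|_]; last by rewrite mulr1z.
move=> /(congr1 (@deg _)); rewrite mulr1z raddfMz /= deg_gen intz raddf0 => ->.
by rewrite !mulr0z.
Qed.

End Definitions.

Lemma deg_pushforward (X Y : topologicalType) n (f : X -> Y) (c : chain R n X) :
  deg (pushforward f c) = deg c.
Proof.
apply: (additive_eq (f := @deg _ \o @pushforward R n X Y f) (g := @deg _)) => s /=.
by rewrite pushforward_gen !deg_gen.
Qed.

Lemma is_cycle_pushforward (X Y : topologicalType) n (f : X -> Y) (c : chain R n X) :
  is_cycle c -> is_cycle (pushforward f c).
Proof.
by case: n c => //= n c zc; rewrite -pushforward_boundary zc raddf0.
Qed.

Lemma reduced_cycle_pushforward (X Y : topologicalType) n (f : X -> Y)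
    (c : chain R n X) :
  reduced_cycle c -> reduced_cycle (pushforward f c).
Proof.
move=> [zc dc]; split; first exact: is_cycle_pushforward.
by rewrite deg_pushforward.
Qed.

Lemma pushforward_cst (X Y : topologicalType) n (e : Y) (c : chain R n X) :
  pushforward (fun=> e) c = gen (constant_simplex e) *~ deg c.
Proof.
apply: (additive_eq (f := @pushforward R n X Y _)
  (g := intmul (gen (constant_simplex e)) \o @deg _)) => s /=.
by rewrite pushforward_gen deg_gen.
Qed.

Lemma pushforward_id (X : topologicalType) n (c : chain R n X) :
  pushforward idfun c = c.
Proof.
apply: (additive_eq (f := @pushforward R n X X _) (g := idfun)) => s /=.
by rewrite pushforward_gen.
Qed.

(** The cycle [z'] bounds a chain [u] in [U] and a chain [v] in [V]; the generator is [u - v], whose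
    image under the connecting map is the class of [z']. *)
Lemma mayer_vietoris (X : topologicalType) (U V : set X) n (z' : chain R n X) :
  open U -> open V ->
  acyclic n U -> acyclic n V -> acyclic n.+1 U -> acyclic n.+1 V ->
  freely_generates (U `&` V) z' ->
  exists z : chain R n.+1 X, freely_generates (U `|` V) z.
Proof.
move=> oU oV acU acV acU1 acV1 [z'z z'UV z'gen z'free].
have subU : U `<=` U `|` V by move=> x; left.
have subV : V `<=` U `|` V by move=> x; right.
have [u Uu z'u] : exists2 u, chain_in U u & z' = boundary u.
  by apply: acU z'z; apply: chain_inS z'UV => x [].
have [v Vv z'v] : exists2 v, chain_in V v & z' = boundary v.
  by apply: acV z'z; apply: chain_inS z'UV => x [].
exists (u - v); split.
- by apply: reduced_cycle_succ; rewrite raddfB /= -z'u -z'v subrr.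
- by apply: onB; [exact: chain_inS Uu|exact: chain_inS Vv].
- move=> c UVc [/= zc _].
  have s0 : small U V (boundary c) by rewrite zc; exact: small0.
  have [_ [h [[a [b [-> Ua Vb]]] UVh cE]]] := small_chains oU oV UVc s0.
  have abz : boundary a = - boundary b.
    apply/eqP; rewrite -addr_eq0 -(raddfD (@boundary R n X)) /=.
    by rewrite -[a + b](addrK (boundary h)) -cE raddfB /= zc boundary_boundary subr0.
  have UVda : chain_in (U `&` V) (boundary a).
    apply: chain_inI; first exact: chain_in_boundary.
    by rewrite abz; apply: onN; exact: chain_in_boundary.
  (* [boundary a] represents the image of [c] under the connecting map, and [m] is its coordinate
     along [z']. Subtracting [u *~ m + w] from [a], and adding [v *~ m + w] to [b], makes both
     cycles. *)
  have [m [w [UVw daE]]] := z'gen _ UVda (reduced_cycle_boundary a).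
  have Uw : chain_in U w by apply: chain_inS UVw => x [].
  have Vw : chain_in V w by apply: chain_inS UVw => x [].
  have [||al Ual alE] := acU1 (a - u *~ m - w).
  + by apply: onB => //; apply: onB => //; exact: onMz.
  + apply: reduced_cycle_succ; rewrite !raddfB raddfMz /= -z'u daE.
    by rewrite (addrC (z' *~ m)) addrK subrr.
  have [||be Vbe beE] := acV1 (b + v *~ m + w).
  + by apply: onD => //; apply: onD => //; exact: onMz.
  + apply: reduced_cycle_succ; rewrite !raddfD raddfMz /= -z'v -addrA -daE abz.
    by rewrite subrr.
  exists m, (al + be + h); split.
    apply: onD => //; apply: onD; [exact: chain_inS Ual|exact: chain_inS Vbe].
  rewrite cE !raddfD /= -alE -beE mulrzBl addrA; congr (_ + _).
  rewrite [X in _ = _ + X]addrACA addNr addr0 [X in _ = _ + X]addrACA [RHS]addrCA.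
  rewrite (addrC (- (u *~ m))).
  by rewrite -(opprB (u *~ m)) subrr addr0.
- move=> m e UVe zmE.
  have se : small U V (boundary e).
    rewrite -zmE mulrzBl; exists (u *~ m), (- v *~ m); split.
    + by rewrite mulNrz.
    + exact: onMz.
    + by apply: onMz; exact: onN.
  have [_ [h [[a [b [-> Ua Vb]]] UVh eE]]] := small_chains oU oV UVe se.
  (* A chain with boundary [z' *~ m]: this expression places it in [U], the one in [wE] places it in
     [V], so freeness of [z'] applies. *)
  pose w := u *~ m - boundary a.
  have wE : w = v *~ m + boundary b.
    apply/eqP; rewrite /w subr_eq -addrA addrC -subr_eq -mulrzBl zmE eE.
    by rewrite raddfD /= boundary_boundary addr0 raddfD addrC.
  apply: (z'free m w); last first.
    by rewrite /w raddfB raddfMz /= boundary_boundary subr0 -z'u.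
  apply: chain_inI.
    by apply: onB; [exact: onMz|exact: chain_in_boundary].
  by rewrite wE; apply: onD; [exact: onMz|exact: chain_in_boundary].
Qed.

(** * Complements of coordinate subspaces *)

Section Euclidean.
Variable N : nat.
Local Notation E := 'rV[R]_N.+1.

Definition star_shaped (U : set E) (e : E) : Prop :=
  U e /\ forall x s, U x -> 0 <= s <= 1 -> U ((1 - s) *: x + s *: e).

Lemma segment_homotopy (X : topologicalType) (f g : X -> E)
    (h : X -> R) :
  continuous f -> continuous g -> continuous h ->
  continuous (fun t => (1 - h t) *: f t + h t *: g t).
Proof.
move=> cf cg ch t; apply: cvgD; apply: cvgZ.
- by apply: cvgB; [exact: cvg_cst|exact: ch].
- exact: cf.
- exact: ch.
- exact: cg.
Qed.

(** Contraction to [e] makes a reduced cycle homologous to a multiple of a constant simplex, still a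
    reduced cycle, to which [constant_bounds] applies. *)
Lemma star_shaped_acyclic (U : set E) e n : star_shaped U e -> acyclic n U.
Proof.
move=> [Ue sU] c Uc zc.
pose H (x : E) (s : R) := (1 - s) *: x + s *: e.
have HU k (sigma : stdsimplex R k -> E) (h : stdsimplex R k -> R) :
    simplex_in U sigma -> continuous h -> (forall t, 0 <= h t <= 1) ->
    simplex_in U (fun t => H (sigma t) (h t)).
  move=> [cs Us] ch h01; split=> [|t]; last exact: sU.
  by apply: segment_homotopy => // t; exact: (@cst_continuous _ _ e).
have [b Ub] := homotopy_invariance HU Uc zc.1.
have -> : H^~ 1 = fun=> e.
  by apply/funext => x; rewrite /H subrr scale0r add0r scale1r.
have -> : H^~ 0 = idfun.
  by apply/funext => x; rewrite /H subr0 scale1r scale0r addr0.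
rewrite pushforward_id => bE.
have [k kE] : exists k, pushforward (fun=> e) c =
    boundary (gen (@constant_simplex _ n.+1 e) *~ k).
  rewrite pushforward_cst; apply: constant_bounds; rewrite -pushforward_cst.
  exact: reduced_cycle_pushforward.
exists (gen (constant_simplex e) *~ k - b).
  by apply: onB => //; apply: onMz; exact: chain_in_constant.
by rewrite raddfB /= -kE -bE opprB addrC subrK.
Qed.

(** The complement of a subspace of codimension [k], with the homotopy type of a sphere of dimension
    [k - 1]. *)
Definition punctured k : set E :=
  [set x | exists i : 'I_N.+1, (i < k)%N /\ x 0 i != 0].

Definition slit (k : 'I_N.+1) (s : R) : set E :=
  [set x | punctured k x \/ 0 < s * x 0 k].

Lemma open_coord_neq0 (i : 'I_N.+1) : open [set x : E | x 0 i != 0].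
Proof.
apply: (@open_comp _ _ (fun x : E => x 0 i) [set y | y != 0]); last exact: open_neq.
by move=> x _; exact: coord_continuous.
Qed.

Lemma open_punctured k : open (punctured k).
Proof.
have -> : punctured k =
    \bigcup_(i in [set i : 'I_N.+1 | (i < k)%N]) [set x : E | x 0 i != 0].
  by apply/seteqP; split=> x [i]; [move=> [ik xi]; exists i|move=> ik xi; exists i].
by apply: bigcup_open => i _; exact: open_coord_neq0.
Qed.

Lemma open_slit k s : open (slit k s).
Proof.
apply: openU; first exact: open_punctured.
apply: (@open_comp _ _ (fun x : E => s * x 0 k) [set y | 0 < y]); last exact: open_gt.
move=> x _; apply: (@continuousM _ _ (fun=> s) (fun x : E => x 0 k)).
  exact: (@cst_continuous _ _ s).
exact: coord_continuous.
Qed.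

(** Moving towards [s *: delta_mx 0 k] rescales the lower coordinates by [1 - t], so a nonzero one
    stays nonzero until the endpoint; [t = 1] is treated apart. *)
Lemma slit_star_shaped k s : s != 0 -> star_shaped (slit k s) (s *: delta_mx 0 k).
Proof.
move=> s0; have ss : 0 < s * s by rewrite -expr2 lt_def sqrf_eq0 s0 sqr_ge0.
split; first by right; rewrite !mxE !eqxx mulr1.
move=> x t Ux /andP[t0]; rewrite le_eqVlt => /predU1P[->|t1].
  by right; rewrite subrr scale0r add0r scale1r !mxE !eqxx mulr1.
case: Ux => [[i [ik xi]]|sx].
  left; exists i; split=> //; rewrite !mxE eqxx /= (_ : (i == k) = false).
    by rewrite !mulr0 addr0 mulf_neq0 // subr_eq0 eq_sym lt_eqF.
  by apply/eqP => ik'; rewrite ik' ltnn in ik.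
right; rewrite !mxE !eqxx mulr1 mulrDr mulrCA [s * (t * s)]mulrCA.
apply: ltr_wpDr; first by apply: mulr_ge0 => //; exact: ltW.
by apply: mulr_gt0; rewrite ?subr_gt0.
Qed.

Lemma slitI (k : 'I_N.+1) : slit k 1 `&` slit k (-1) = punctured k.
Proof.
apply/seteqP; split=> x; last by move=> xk; split; left.
by case=> [[//|x1] [//|x2]]; move: x1 x2; rewrite mul1r mulN1r; lra.
Qed.

Lemma slitU (k : 'I_N.+1) : slit k 1 `|` slit k (-1) = punctured k.+1.
Proof.
apply/seteqP; split=> x.
  by case=> -[[i [ik xi]]|xk]; first [exists i; split=> //; exact: ltnW
    | exists k; split=> //; apply/eqP => x0; move: xk; rewrite x0 mulr0 ltxx].
case=> i [ik xi]; move: ik; rewrite ltnS leq_eqVlt => /predU1P[/val_inj ik|ik].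
  rewrite -ik; move: xi; rewrite neq_lt => /orP[xi|xi]; [right|left]; right.
    by rewrite mulN1r oppr_gt0.
  by rewrite mul1r.
by left; left; exists i.
Qed.

(** The base case is done by hand, since Mayer-Vietoris would need homology of the empty set in
    degree -1. The generator is the difference of a point in each half-space. *)
Lemma punctured1_generator : exists z : chain R 0 E, freely_generates (punctured 1) z.
Proof.
pose e : E := delta_mx 0 ord0.
pose U := slit ord0 1; pose V := slit ord0 (-1).
have [oU oV] : open U /\ open V by split; exact: open_slit.
have Ue : star_shaped U (1 *: e) by apply: slit_star_shaped; exact: oner_neq0.
have Ve : star_shaped V (- 1 *: e) by apply: slit_star_shaped; rewrite oppr_eq0 oner_neq0.
have subU : U `<=` U `|` V by move=> x; left.
have subV : V `<=` U `|` V by move=> x; right.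
pose p : chain R 0 E := gen (constant_simplex (1 *: e)).
pose q : chain R 0 E := gen (constant_simplex (- 1 *: e)).
have Up : chain_in U p by apply: chain_in_constant; case: Ue.
have Vq : chain_in V q by apply: chain_in_constant; case: Ve.
have small_all (c : chain R 0 E) : chain_in (U `|` V) c -> small U V c.
  move=> UVc; apply: on_split; apply: sub_on UVc => s [cs UVs].
  (* The standard 0-simplex is a single point, so a 0-simplex in the union already lies in one of
     the two sets. *)
  have st t : s t = s (center R 0).
    congr s; apply: val_inj; rewrite -!set_valE; apply/rowP => i.
    have [_] := set_valP t; have [_] := set_valP (center R 0).
    by rewrite !big_ord1 !ord1 => -> ->.
  by case: (UVs (center R 0)) => Ws; [left|right]; split=> // t; rewrite st.
have -> : punctured 1 = U `|` V by rewrite /U /V (slitU ord0).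
exists (p - q); split.
- by split=> // _; rewrite raddfB /= !deg_gen subrr.
- by apply: onB; [exact: chain_inS Up|exact: chain_inS Vq].
- move=> c UVc [_ /(_ erefl) dc].
  have [a [b [cE Ua Vb]]] := small_all c UVc.
  have [||al Ual alE] := star_shaped_acyclic (n := 0) Ue (c := a - p *~ deg a).
  + by apply: onB => //; exact: onMz.
  + by split=> // _; rewrite raddfB raddfMz /= deg_gen intz subrr.
  have [||be Vbe beE] := star_shaped_acyclic (n := 0) Ve (c := b - q *~ deg b).
  + by apply: onB => //; exact: onMz.
  + by split=> // _; rewrite raddfB raddfMz /= deg_gen intz subrr.
  exists (deg a), (al + be); split.
    by apply: onD; [exact: chain_inS Ual|exact: chain_inS Vbe].
  have db : deg b = - deg a by apply/eqP; rewrite -addr_eq0 addrC -raddfD /= -cE dc.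
  rewrite raddfD /= -alE -beE cE mulrzBl db mulrNz opprK [X in _ = _ + X]addrACA.
  rewrite [RHS]addrCA.
  by rewrite (addrC (- (p *~ _))) -(opprB (p *~ _)) subrr addr0.
- move=> m b UVb zmE.
  have sb : small U V (boundary b) by apply: small_all; exact: chain_in_boundary.
  have [_ [h [[a [a' [-> Ua Va']]] UVh bE]]] := small_chains oU oV UVb sb.
  pose w := p *~ m - boundary a.
  have wE : w = q *~ m + boundary a'.
    apply/eqP; rewrite /w subr_eq -addrA addrC -subr_eq -mulrzBl zmE bE.
    by rewrite raddfD /= boundary_boundary addr0 raddfD addrC.
  have : chain_in (U `&` V) w.
    apply: chain_inI.
      by apply: onB; [exact: onMz|exact: chain_in_boundary].
    by rewrite wE; apply: onD; [exact: onMz|exact: chain_in_boundary].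
  (* The intersection is [punctured 0], which is empty, so [w] has no simplices, whereas its degree
     is [m]. *)
  rewrite slitI => w0; have : deg w = 0.
    have /eqP -> : w == 0.
      rewrite -dom_eq0; case E0: (dom w) => [//|s r].
      by have [] := w0 s; rewrite ?E0 ?mem_head // => _ /(_ (center R 0))[i []].
    by rewrite raddf0.
  by rewrite /w raddfB raddfMz /= deg_gen intz deg_boundary subr0.
Qed.

Lemma punctured_generator k : (k <= N)%N ->
  exists z : chain R k E, freely_generates (punctured k.+1) z.
Proof.
elim: k => [_|k IH kN]; first exact: punctured1_generator.
have [z zg] := IH (ltnW kN).
pose i : 'I_N.+1 := Ordinal (kN : (k.+1 < N.+1)%N).
rewrite -(slitU i).
apply: mayer_vietoris; try exact: open_slit; last by rewrite slitI; exact: zg.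
all: apply: star_shaped_acyclic; apply: slit_star_shaped.
all: by rewrite ?oppr_eq0 oner_neq0.
Qed.

Lemma nonzero_generator : exists z : chain R N E, freely_generates [set x : E | x != 0] z.
Proof.
have [z zg] := punctured_generator (leqnn N); exists z.
suff -> : [set x : E | x != 0] = punctured N.+1 by [].
apply/seteqP; split=> x /= => [x0|[i [_ xi]]].
  have [//|] := pselect (punctured N.+1 x) => xN; case/eqP: x0.
  apply/rowP => i; rewrite mxE; apply: contra_notP xN => /eqP xi.
  by exists i; rewrite ltn_ord.
by apply: contraNneq xi => ->; rewrite mxE.
Qed.

End Euclidean.
End ReducedHomology.

(** * The sphere and the degree *)

Section Normalization.
Variables (R : realType) (N : nat).
Local Notation E := 'rV[R]_N.+1.
Local Notation S := (sphere R N).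
Implicit Types (x y : E) (a : R).

Lemma enorm_sqr x : enorm x ^+ 2 = \sum_i x 0 i ^+ 2.
Proof. by rewrite sqr_sqrtr //; apply: sumr_ge0 => i _; exact: sqr_ge0. Qed.

Lemma enorm_ge0 x : 0 <= enorm x.
Proof. exact: sqrtr_ge0. Qed.

Lemma enormZ a x : enorm (a *: x) = `|a| * enorm x.
Proof.
rewrite /enorm -sqrtr_sqr -sqrtrM ?sqr_ge0 // mulr_sumr; congr Num.sqrt.
by apply: eq_bigr => i _; rewrite mxE exprMn.
Qed.

Lemma enormN x : enorm (- x) = enorm x.
Proof. by rewrite -scaleN1r enormZ normrN1 mul1r. Qed.

Lemma enorm_gt0 x : (0 < enorm x) = (x != 0).
Proof.
rewrite lt_def enorm_ge0 andbT; congr (~~ _); apply/eqP/eqP => [x0|->].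
  apply/rowP => i; apply/eqP; rewrite mxE -sqrf_eq0 eq_le sqr_ge0 andbT.
  have <- : \sum_i x 0 i ^+ 2 = 0 by rewrite -enorm_sqr x0 expr0n.
  by rewrite (bigD1 i) //= lerDl; apply: sumr_ge0 => j _; exact: sqr_ge0.
by rewrite -[X in enorm X](scale0r 0) enormZ normr0 mul0r.
Qed.

Lemma enorm_sphere (u : S) : enorm (set_val u) = 1.
Proof. exact: (set_valP u). Qed.

Lemma sphere_neq0 (u : S) : set_val u != 0.
Proof. by rewrite -enorm_gt0 enorm_sphere ltr01. Qed.

Lemma enorm_delta i : enorm (delta_mx 0 i : E) = 1.
Proof.
rewrite /enorm (bigD1 i) //= big1 => [|j ji].
  by rewrite !mxE !eqxx expr1n addr0 sqrtr1.
by rewrite !mxE (negbTE ji) expr0n.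
Qed.

Lemma delta_sphere i : (delta_mx 0 i : E) \in S.
Proof. by apply/mem_set; exact: enorm_delta. Qed.

Definition axis i : S := SigSub (delta_sphere i).

Definition normalize x : S := insubd (axis ord0) ((enorm x)^-1 *: x).

Lemma set_val_normalize x : x != 0 -> set_val (normalize x) = (enorm x)^-1 *: x.
Proof.
move=> x0; rewrite set_valE val_insubd mem_set //= /sphere /= enormZ.
have ex : 0 < enorm x by rewrite enorm_gt0.
by rewrite ger0_norm ?invr_ge0 ?ltW // mulVf // gt_eqF.
Qed.

Lemma normalizeZ (u : S) a : 0 < a -> normalize (a *: set_val u) = u.
Proof.
move=> a0; apply: val_inj; rewrite -!set_valE set_val_normalize.
  by rewrite enormZ enorm_sphere mulr1 gtr0_norm // scalerA mulVf ?scale1r // gt_eqF.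
by rewrite scaler_eq0 negb_or sphere_neq0 andbT gt_eqF.
Qed.

Lemma normalizeK (u : S) : normalize (set_val u) = u.
Proof. by rewrite -[set_val u]scale1r normalizeZ // ltr01. Qed.

Lemma continuous_enorm (T : topologicalType) (f : T -> E) :
  continuous f -> continuous (fun t => enorm (f t)).
Proof.
move=> cf t; apply: (@continuous_comp _ _ _ (fun t => \sum_i f t 0 i ^+ 2) Num.sqrt).
  apply: continuous_sum => i {}t; apply: (@continuous_comp _ _ _ (fun t => f t 0 i) (fun y : R => y ^+ 2)).
    exact: continuous_entry.
  exact: exprn_continuous.
exact: sqrt_continuous.
Qed.

Lemma continuous_normalize (T : topologicalType) (f : T -> E) :
  continuous f -> (forall t, f t != 0) -> continuous (fun t => normalize (f t)).
Proof.
move=> cf f0; apply: continuous_set_type.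
have -> : set_val \o (fun t => normalize (f t)) = fun t => (enorm (f t))^-1 *: f t.
  by apply/funext => t /=; rewrite set_val_normalize.
move=> t; apply: cvgZ; last exact: cf.
by apply: cvgV; [rewrite gt_eqF // enorm_gt0|exact: continuous_enorm].
Qed.

Definition nonzero : set E := [set x | x != 0].

Lemma simplex_in_normalize n (s : stdsimplex R n -> E) :
  simplex_in nonzero s -> simplex_in [set: S] (normalize \o s).
Proof. by move=> [cs s0]; split=> //; exact: continuous_normalize. Qed.

Lemma simplex_in_set_val n (s : stdsimplex R n -> S) :
  simplex_in [set: S] s -> simplex_in nonzero (set_val \o s).
Proof.
move=> [cs _]; split=> [t|t]; last exact: sphere_neq0.
by apply: continuous_comp; [exact: cs|exact: continuous_set_val].
Qed.

(** Normalization carries the generator over. Generation follows because [normalize] is a left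
    inverse of the inclusion, freeness because the inclusion after [normalize] is homotopic to the
    identity off the origin. *)
Lemma sphere_generator : exists z : chain R N S, freely_generates setT z.
Proof.
have [z [zz z0 zgen zfree]] := @nonzero_generator R N.
exists (pushforward normalize z); split.
- exact: reduced_cycle_pushforward.
- by apply: chain_in_pushforward z0 => s; exact: simplex_in_normalize.
- move=> c cS cz.
  have [||m [b [b0 cE]]] := zgen (pushforward set_val c).
  + by apply: chain_in_pushforward cS => s; exact: simplex_in_set_val.
  + exact: reduced_cycle_pushforward.
  exists m, (pushforward normalize b); split.
    by apply: chain_in_pushforward b0 => s; exact: simplex_in_normalize.
  rewrite -pushforward_boundary -(raddfMz (pushforward normalize)) /=.
  rewrite -(raddfD (pushforward normalize)) /= -cE pushforward_comp.
  rewrite (_ : _ \o _ = idfun) ?pushforward_id //.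
  by apply/funext => u; exact: normalizeK.
move=> m b bS zmE.
(* Radial, so for [s] in the unit interval it multiplies [x] by a positive scalar and avoids the
   origin. *)
pose H x (s : R) := (1 - s) *: x + s *: set_val (normalize x).
have HU k (s : stdsimplex R k -> E) (h : stdsimplex R k -> R) :
    simplex_in nonzero s -> continuous h -> (forall t, 0 <= h t <= 1) ->
    simplex_in nonzero (fun t => H (s t) (h t)).
  move=> [cs s0] ch h01; split=> [|t].
    apply: (segment_homotopy (f := s) (g := fun t => set_val (normalize (s t)))) => //.
    move=> t; apply: (@continuous_comp _ _ _ (normalize \o s) set_val).
      exact: continuous_normalize.
    exact: continuous_set_val.
  have /andP[h0 h1] := h01 t.
  rewrite /nonzero /= /H set_val_normalize; last exact: s0.
  rewrite scalerA -scalerDl scaler_eq0 negb_or [s t != 0]s0 andbT.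
  have e0 : 0 < (enorm (s t))^-1 by rewrite invr_gt0 enorm_gt0; exact: s0.
  rewrite gt_eqF //; move: h0; rewrite le_eqVlt => /predU1P[<-|h0].
    by rewrite subr0 mul0r addr0 ltr01.
  by apply: ltr_wpDl; [rewrite subr_ge0|exact: mulr_gt0].
have [be be0] := homotopy_invariance HU z0 zz.1.
have -> : H^~ 1 = set_val \o normalize.
  by apply/funext => x; rewrite /H subrr scale0r add0r scale1r.
have -> : H^~ 0 = idfun.
  by apply/funext => x; rewrite /H subr0 scale1r scale0r addr0.
rewrite pushforward_id -pushforward_comp => beE.
apply: (zfree m (pushforward set_val b - be *~ m)).
  apply: onB; last exact: onMz.
  by apply: chain_in_pushforward bS => s; exact: simplex_in_set_val.
rewrite raddfB raddfMz /= -beE -pushforward_boundary -zmE raddfMz /=.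
by rewrite mulrzBl opprB addrC subrK.
Qed.

End Normalization.

Section Degree.
Variables (R : realType).

(** No cycle condition, so that the pieces of a cycle over the two caps can be compared as well. *)
Definition homologous (X : topologicalType) n (c1 c2 : chain R n X) : Prop :=
  exists2 b, singular b & c1 - c2 = boundary b.

Section Homologous.
Variables (X : topologicalType) (n : nat).
Implicit Types c : chain R n X.

Lemma homologous_refl c : homologous c c.
Proof. by exists 0; [move=> s; rewrite dom0|rewrite subrr raddf0]. Qed.

Lemma homologous_sym c1 c2 : homologous c1 c2 -> homologous c2 c1.
Proof.
move=> [b /singularE sb bE]; exists (- b); first by apply/singularE; exact: onN.
by rewrite raddfN /= -bE opprB.
Qed.

Lemma homologousD c1 c2 c3 c4 :
  homologous c1 c2 -> homologous c3 c4 -> homologous (c1 + c3) (c2 + c4).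
Proof.
move=> [b /singularE sb bE] [b' /singularE sb' bE'].
exists (b + b'); first by apply/singularE; exact: onD.
by rewrite opprD addrACA bE bE' raddfD.
Qed.

Lemma homologousMz c1 c2 m : homologous c1 c2 -> homologous (c1 *~ m) (c2 *~ m).
Proof.
move=> [b /singularE sb bE]; exists (b *~ m); first by apply/singularE; exact: onMz.
by rewrite -mulrzBl bE raddfMz.
Qed.

Lemma homologous_trans c2 c1 c3 :
  homologous c1 c2 -> homologous c2 c3 -> homologous c1 c3.
Proof.
move=> [b /singularE sb bE] [b' /singularE sb' bE'].
exists (b + b'); first by apply/singularE; exact: onD.
by rewrite -(subrKA c2) bE bE' raddfD.
Qed.

Lemma homologous_boundary c b : singular b -> homologous (c + boundary b) c.
Proof. by move=> sb; exists b => //; rewrite addrC addKr. Qed.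

End Homologous.

Lemma homologous_pushforward (X Y : topologicalType) n (f : X -> Y)
    (c1 c2 : chain R n X) : continuous f ->
  homologous c1 c2 -> homologous (pushforward f c1) (pushforward f c2).
Proof.
move=> cf [b sb bE]; exists (pushforward f b); first exact: chain_in_continuous.
by rewrite -pushforward_boundary -bE raddfB.
Qed.

Definition homotopic (X Y : topologicalType) (f g : X -> Y) : Prop :=
  exists H : X * R -> Y,
    [/\ continuous H, forall x, H (x, 0) = f x & forall x, H (x, 1) = g x].

Lemma homotopic_homologous (X Y : topologicalType) (f g : X -> Y) n
    (c : chain R n X) :
  homotopic f g -> singular c -> is_cycle c ->
  homologous (pushforward f c) (pushforward g c).
Proof.
move=> [H [cH H0 H1]] /singularE sc zc; apply: homologous_sym.
have HU k (s : stdsimplex R k -> X) (h : stdsimplex R k -> R) :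
    simplex_in [set: X] s -> continuous h -> (forall t, 0 <= h t <= 1) ->
    simplex_in [set: Y] (fun t => H (s t, h t)).
  move=> [cs _] ch _; split=> // t.
  apply: (@continuous_comp _ _ _ (fun t => (s t, h t)) H); last exact: cH.
  exact: cvg_pair (cs t) (ch t).
have [b /singularE sb bE] := homotopy_invariance (H := fun x s => H (x, s)) HU sc zc.
exists b => //; rewrite -bE.
have -> : g = fun x => H (x, 1) by apply/funext => x; rewrite H1.
by have -> : f = fun x => H (x, 0) by apply/funext => x; rewrite H0.
Qed.

Lemma homotopic_compl (X Y Z : topologicalType) (f g : X -> Y) (k : Y -> Z) :
  continuous k -> homotopic f g -> homotopic (k \o f) (k \o g).
Proof.
move=> ck [H [cH H0 H1]]; exists (k \o H); split=> [x|x|x] /=.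
- by apply: continuous_comp; [exact: cH|exact: ck].
- by rewrite H0.
- by rewrite H1.
Qed.

(** * Straight-line homotopies on the sphere, and computation of the degree *)

Section Sphere.
Variable N : nat.
Local Notation S := (sphere R N).

(** The retraction of the line onto the unit interval. It turns a segment into a homotopy defined
    for all real times, as [homotopic] asks. *)
Definition clamp (s : R) : R := (`|s| - `|s - 1| + 1) / 2.

Lemma clamp0 : clamp 0 = 0.
Proof. by rewrite /clamp normr0 !sub0r normrN1 addNr mul0r. Qed.

Lemma clamp1 : clamp 1 = 1.
Proof. by rewrite /clamp subrr normr0 normr1; lra. Qed.

Lemma clamp_continuous : continuous clamp.
Proof.
move=> s; apply: cvgM; last exact: cvg_cst.
apply: cvgD; last exact: cvg_cst.
apply: cvgB; apply: cvg_norm; first exact: cvg_id.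
by apply: cvgB; [exact: cvg_id|exact: cvg_cst].
Qed.

Lemma clamp_itv s : 0 <= clamp s <= 1.
Proof.
have := ler_dist_dist s (s - 1).
rewrite subKr normr1 ler_norml /clamp => /andP[s1 s2].
by apply/andP; split; lra.
Qed.

(** If the segment meets the origin, comparing norms gives [1 - s = s], so the midpoint vanishes and
    the ends are antipodal. *)
Lemma sphere_segment_neq0 (u v : S) (s : R) : 0 <= s <= 1 ->
  set_val u + set_val v != 0 -> (1 - s) *: set_val u + s *: set_val v != 0.
Proof.
move=> /andP[s0 s1]; apply: contra_neq => /eqP; rewrite addr_eq0 => /eqP uv.
have := congr1 (@enorm R _) uv; rewrite enormN !enormZ !enorm_sphere !mulr1.
rewrite !ger0_norm ?subr_ge0 // => sE.
have s2 : s = 2^-1 by lra.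
move: uv; rewrite sE -scalerN => /scalerI -> //; first by rewrite addNr.
by rewrite s2 invr_eq0 pnatr_eq0.
Qed.

Lemma nonantipodal_homotopic (X : topologicalType) (f g : X -> S) :
  continuous f -> continuous g ->
  (forall x, set_val (f x) + set_val (g x) != 0) -> homotopic f g.
Proof.
move=> cf cg fg.
exists (fun xs : X * R => normalize ((1 - clamp xs.2) *: set_val (f xs.1)
  + clamp xs.2 *: set_val (g xs.1))).
split=> [|x|x] /=.
- have cfst (k : X -> S) : continuous k -> continuous (fun xs : X * R => set_val (k xs.1)).
    move=> ck xs; apply: (@continuous_comp _ _ _ (k \o fst) set_val).
      by apply: continuous_comp; [exact: cvg_fst|exact: ck].
    exact: continuous_set_val.
  apply: continuous_normalize.
    apply: (segment_homotopy (f := fun xs : X * R => set_val (f xs.1))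
      (g := fun xs : X * R => set_val (g xs.1)) (h := fun xs : X * R => clamp xs.2)).
    + exact: cfst.
    + exact: cfst.
    + by move=> xs; apply: continuous_comp; [exact: cvg_snd|exact: clamp_continuous].
  by move=> xs; apply: sphere_segment_neq0; [exact: clamp_itv|exact: fg].
- by rewrite clamp0 subr0 scale1r scale0r addr0 normalizeK.
- by rewrite clamp1 subrr scale0r add0r scale1r normalizeK.
Qed.

Hypothesis N0 : (0 < N)%N.
Variable z : chain R N S.
Hypothesis zgen : freely_generates setT z.

Lemma reduced_cycle_of_cycle (c : chain R N S) : is_cycle c -> reduced_cycle c.
Proof. by move=> zc; split=> // /eqP; rewrite -[_ == _]negbK -lt0n N0. Qed.

(** Since [z] generates, the relation on [z] extends to every cycle; hence the set defining
    [degree f] is inhabited and [xget] returns a member. Freeness of [z] identifies that member with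
    [d]. *)
Lemma degree_eq (f : S -> S) (d : int) : continuous f ->
  homologous (pushforward f z) (z *~ d) -> degree f = d.
Proof.
case: zgen => zz /singularE zS gen free cf fz.
have acts : acts_by R N f d.
  move=> c /singularE sc zc.
  have [m [b [/singularE sb cE]]] := gen c sc (reduced_cycle_of_cycle zc).
  have cm : homologous c (z *~ m) by rewrite cE; exact: homologous_boundary.
  have [b' sb' bE] : homologous (pushforward f c) (c *~ d).
    apply: (homologous_trans (homologous_pushforward cf cm)).
    rewrite raddfMz /=; apply: homologous_trans (homologousMz m fz) _.
    by rewrite mulrzAC; apply: homologousMz; exact: homologous_sym.
  by exists b'.
have acts' : acts_by R N f (degree f).
  by apply: (@xgetPex _ _ [set k | acts_by R N f k]); exists d.
have [b [sb bE]] := acts' z zS zz.1.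
have [b' /singularE sb' bE'] : homologous (z *~ d) (z *~ degree f).
  by apply: homologous_trans (homologous_sym fz) _; exists b.
apply/esym/eqP; rewrite -subr_eq0; apply/eqP; apply: (free _ b') => //.
by rewrite mulrzBr.
Qed.

Lemma degree_homologous (f : S -> S) : continuous f ->
  homologous (pushforward f z) (z *~ degree f).
Proof.
move=> cf; case: zgen => zz /singularE zS gen free.
have [|m [b [/singularE sb fzE]]] := gen _ _ (reduced_cycle_pushforward f zz).
  by apply/singularE; exact: chain_in_continuous.
have fz : homologous (pushforward f z) (z *~ m).
  by rewrite fzE; exact: homologous_boundary.
by rewrite (degree_eq cf fz).
Qed.

End Sphere.
End Degree.

(** * Products *)

Lemma smooth_continuous (R : realType) m n (f : sphere R m -> sphere R n) :
  smooth f -> continuous f.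
Proof.
move=> sf; apply: continuous_set_type => t.
have [U [G [oU Ut sG fG]]] := sf t.
(* The empty list of partial derivatives yields continuity of [G] itself. *)
have [cG _] := sG [::] _ Ut.
have Ut' : \forall s \near t, U (set_val s).
  by apply: (continuous_set_val (A := sphere R m)); exact: open_nbhs_nbhs.
have cGv : {for t, continuous (G \o set_val : sphere R m -> _)}.
  apply: (@continuous_comp _ _ _ set_val G); last exact: cG.
  exact: continuous_set_val.
move=> W; rewrite /= fG // => /cGv GW.
have : nbhs t ([set s | W (G (set_val s))] `&` [set s | U (set_val s)]).
  exact: filterI.
by apply: filterS => s [Ws Us] /=; rewrite fG.
Qed.

Section Multiplication.
Variables (R : realType) (A : algebra).
Local Notation E := 'rV[R]_(sdim A).+1.
Local Notation S := (sphere R (sdim A)).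

Lemma amulDl (x y w : E) : amul (x + y) w = amul x w + amul y w.
Proof.
apply/rowP => k; rewrite !mxE -big_split; apply: eq_bigr => i _ /=.
rewrite -big_split; apply: eq_bigr => j _ /=.
by rewrite !mxE mulrDl mulrDr.
Qed.

Lemma amulDr (w x y : E) : amul w (x + y) = amul w x + amul w y.
Proof.
apply/rowP => k; rewrite !mxE -big_split; apply: eq_bigr => i _ /=.
rewrite -big_split; apply: eq_bigr => j _ /=.
by rewrite !mxE mulrDr mulrDr.
Qed.

Definition one : S := axis R (ord0 : 'I_(sdim A).+1).

Lemma amul1l (x : E) : amul (delta_mx 0 ord0) x = x.
Proof.
apply/rowP => k; rewrite mxE (bigD1 ord0) //= [X in _ + X]big1 ?addr0 => [|i i0].
  rewrite (bigD1 k) //= big1 ?addr0 => [|j jk].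
    by rewrite /structure_constant /= eqxx !mxE !eqxx !mul1r.
  by rewrite /structure_constant /= (_ : _ == _ = false) ?mul0r //; apply: negbTE.
by rewrite big1 // => j _; rewrite mxE (negbTE i0) andbF mul0r mulr0.
Qed.

Lemma amul1r (x : E) : amul x (delta_mx 0 ord0) = x.
Proof.
apply/rowP => k; rewrite mxE (bigD1 k) //= [X in _ + X]big1 ?addr0 => [|i ik].
  rewrite (bigD1 ord0) //= big1 ?addr0 => [|j j0]; last first.
    by rewrite [delta_mx _ _ _ _]mxE (negbTE j0) andbF !mulr0.
  rewrite /structure_constant /= mxE !eqxx mulr1; case: eqP => [k0|_].
    by rewrite k0 eqxx mul1r.
  by rewrite mul1r.
rewrite (bigD1 ord0) //= big1 ?addr0 => [|j j0]; last first.
  by rewrite [delta_mx _ _ _ _]mxE (negbTE j0) andbF !mulr0.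
rewrite /structure_constant /=; case: eqP => [i0|_].
  rewrite (_ : _ == _ = false) ?mul0r //; apply: contraNF ik => /eqP ki.
  by apply/eqP/val_inj; rewrite /= i0 ki.
by rewrite (_ : _ == _ = false) ?mul0r //; apply: negbTE.
Qed.

Lemma enorm_amul (x y : E) : enorm (amul x y) = enorm x * enorm y.
Proof.
by rewrite /enorm amul_norm2 sqrtrM //; apply: sumr_ge0 => i _; exact: sqr_ge0.
Qed.

Lemma amul_neq0 (x y : E) : x != 0 -> y != 0 -> amul x y != 0.
Proof. by rewrite -!enorm_gt0 enorm_amul => x0 y0; exact: mulr_gt0. Qed.

Lemma set_val_sphere_mul (u v : S) :
  set_val (sphere_mul u v) = amul (set_val u) (set_val v).
Proof. exact: set_val_SigSub. Qed.

Lemma continuous_sphere_mul (X : topologicalType) (f g : X -> S) :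
  continuous f -> continuous g -> continuous (fun x => sphere_mul (f x) (g x)).
Proof.
move=> cf cg; apply: continuous_set_type.
have cv (h : X -> S) i : continuous h -> continuous (fun x => set_val (h x) 0 i).
  move=> ch; apply: continuous_entry => x.
  by apply: (@continuous_comp _ _ _ h set_val); [exact: ch|exact: continuous_set_val].
apply: continuous_matrix => i k.
rewrite (_ : (fun x => _) = fun x =>
    \sum_(p < (sdim A).+1) \sum_(q < (sdim A).+1)
      structure_constant R A p q k * (set_val (f x) 0 p * set_val (g x) 0 q));
  last first.
  by apply/funext => x; rewrite /= set_val_sphere_mul ord1 mxE.
apply: continuous_sum => p; apply: continuous_sum => q x.
apply: (@continuousM _ _ (fun=> structure_constant R A p q k)
  (fun x => set_val (f x) 0 p * set_val (g x) 0 q)).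
  exact: (@cst_continuous _ _ (structure_constant R A p q k)).
by apply: (@continuousM _ _ (fun x => set_val (f x) 0 p) (fun x => set_val (g x) 0 q));
  exact: cv.
Qed.

Lemma homotopic_mul (X : topologicalType) (f f' g g' : X -> S) :
  homotopic R f f' -> homotopic R g g' ->
  homotopic R (fun x => sphere_mul (f x) (g x)) (fun x => sphere_mul (f' x) (g' x)).
Proof.
move=> [H [cH H0 H1]] [K [cK K0 K1]].
exists (fun xs => sphere_mul (H xs) (K xs)); split=> [|x|x].
- exact: continuous_sphere_mul.
- by rewrite H0 K0.
- by rewrite H1 K1.
Qed.

(* [a] is joined to the unit through some [b] antipodal to neither. *)
Lemma sphere_bridge (a : S) : exists b : S,
  set_val a + set_val b != 0 /\ set_val b + set_val one != 0.
Proof.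
have sv i : set_val (axis R (i : 'I_(sdim A).+1)) = delta_mx 0 i by exact: set_val_SigSub.
have [a1|a1] := eqVneq (set_val a + set_val one) 0; last first.
  exists one; split=> //; rewrite sv; apply/eqP => /rowP /(_ ord0).
  by rewrite !mxE !eqxx /=; lra.
have d0 : (1 < (sdim A).+1)%N by case: (A).
pose i : 'I_(sdim A).+1 := Ordinal d0.
exists (axis R i); rewrite !sv; split; apply/eqP => /rowP.
  have -> : set_val a = - delta_mx 0 ord0.
    by apply/eqP; rewrite -addr_eq0 -sv a1.
  by move=> /(_ i); rewrite !mxE !eqxx /=; lra.
by move=> /(_ i); rewrite !mxE !eqxx /=; lra.
Qed.

(** If [d + d'] is nonzero, so is [f x * (d + d')], as the norm is multiplicative; the two products
    are then nowhere antipodal. Two such steps lead from [a] through the bridge to the unit. *)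
Lemma homologous_mul_right n (f : S -> S) (a : S) (c : chain R n S) :
  continuous f -> singular c -> is_cycle c ->
  homologous (pushforward (fun x => sphere_mul (f x) a) c) (pushforward f c).
Proof.
move=> cf sc zc; have [b [ab b1]] := sphere_bridge a.
have cm d : continuous (fun x => sphere_mul (f x) d).
  by apply: continuous_sphere_mul => //; exact: (@cst_continuous _ _ d).
have step d d' : set_val d + set_val d' != 0 ->
    homologous (pushforward (fun x => sphere_mul (f x) d) c)
      (pushforward (fun x => sphere_mul (f x) d') c).
  move=> dd; apply: homotopic_homologous => //; apply: nonantipodal_homotopic => // x.
  by rewrite !set_val_sphere_mul -amulDr; apply: amul_neq0 => //; exact: sphere_neq0.
have fE : f = fun x => sphere_mul (f x) one.
  apply/funext => x; apply: val_inj.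
  by rewrite -!set_valE set_val_sphere_mul set_val_SigSub amul1r.
rewrite [X in homologous _ (pushforward X _)]fE.
exact: homologous_trans (step _ _ ab) (step _ _ b1).
Qed.

Lemma homologous_mul_left n (f : S -> S) (a : S) (c : chain R n S) :
  continuous f -> singular c -> is_cycle c ->
  homologous (pushforward (fun x => sphere_mul a (f x)) c) (pushforward f c).
Proof.
move=> cf sc zc; have [b [ab b1]] := sphere_bridge a.
have cm d : continuous (fun x => sphere_mul d (f x)).
  by apply: continuous_sphere_mul => //; exact: (@cst_continuous _ _ d).
have step d d' : set_val d + set_val d' != 0 ->
    homologous (pushforward (fun x => sphere_mul d (f x)) c)
      (pushforward (fun x => sphere_mul d' (f x)) c).
  move=> dd; apply: homotopic_homologous => //; apply: nonantipodal_homotopic => // x.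
  by rewrite !set_val_sphere_mul -amulDl; apply: amul_neq0 => //; exact: sphere_neq0.
have fE : f = fun x => sphere_mul one (f x).
  apply/funext => x; apply: val_inj.
  by rewrite -!set_valE set_val_sphere_mul set_val_SigSub amul1l.
rewrite [X in homologous _ (pushforward X _)]fE.
exact: homologous_trans (step _ _ ab) (step _ _ b1).
Qed.

End Multiplication.

(** * Collapsing a cap to a pole *)

Section Collapse.
Variables (R : realType) (N : nat).
Local Notation E := 'rV[R]_N.+1.
Local Notation S := (sphere R N).
Local Notation e0 := (delta_mx 0 ord0 : E).

(* [(`|y| + y) / 2] is the positive part of [y = s x_0 - 1/2], so that the cap
   [s x_0 <= 1/2] is sent to the pole [- s]. *)
Definition collapse_vector (s : R) (x : S) : E :=
  ((`|s * set_val x 0 ord0 - 2^-1| + (s * set_val x 0 ord0 - 2^-1)) / 2) *: set_val x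
  - (s / 8) *: e0.

Definition collapse (s : R) (x : S) : S := normalize (collapse_vector s x).

(** Vanishing would force [a + l = 1/8] by norms and then [x = s *: e0], where [a] is already [1/2]:
    the constant 8 makes the shift shorter than that. The case [l = 0] makes [collapse] well
    defined, [l > 0] keeps it from being antipodal to the identity. *)
Lemma collapse_vector_neq (s : R) (x : S) (l : R) : s * s = 1 -> 0 <= l ->
  collapse_vector s x + l *: set_val x != 0.
Proof.
move=> s1 l0; rewrite /collapse_vector; set y := _ - 2^-1; set a := _ / 2.
have y0 : 0 <= `|y| by [].
have a0 : 0 <= a by have := ler_norm (- y); rewrite normrN /a; lra.
have n1 : `|s| = 1.
  by apply/eqP; rewrite -(@pexpr_eq1 _ _ 2) // real_normK ?num_real // expr2 s1.
apply/eqP => /eqP; rewrite addrAC -scalerDl subr_eq0 => /eqP E0.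
have mu : a + l = 8^-1.
  have := congr1 (@enorm R _) E0; rewrite !enormZ enorm_sphere enorm_delta !mulr1.
  by rewrite ger0_norm ?addr_ge0 // => ->; rewrite normrM n1 mul1r ger0_norm ?invr_ge0.
have x0 : set_val x 0 ord0 = s.
  have := congr1 (fun v : E => v 0 ord0) E0; rewrite mu !mxE !eqxx /=; lra.
have yE : y = 2^-1 by rewrite /y x0 s1; lra.
have aE : a = 2^-1 by rewrite /a yE ger0_norm //; lra.
by move: mu; rewrite aE; lra.
Qed.

Lemma collapse_vector_neq0 (s : R) (x : S) : s * s = 1 -> collapse_vector s x != 0.
Proof. by move=> s1; have := collapse_vector_neq x s1 (lexx 0); rewrite scale0r addr0. Qed.

Lemma collapse_vector_continuous (T : topologicalType) (f : T -> S) (s : R) :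
  continuous (fun t => set_val (f t)) ->
  continuous (fun t => collapse_vector s (f t)).
Proof.
move=> cf; rewrite /collapse_vector.
pose y t := s * set_val (f t) 0 ord0 - 2^-1.
have cy : continuous y.
  move=> t; apply: cvgB; last exact: cvg_cst.
  by apply: cvgM; [exact: cvg_cst|exact: (continuous_entry (i := 0) (j := ord0) cf)].
move=> t; apply: cvgB; last exact: cvg_cst.
apply: cvgZ; last exact: cf.
apply: cvgM; last exact: cvg_cst.
by apply: cvgD; [apply: cvg_norm; exact: cy|exact: cy].
Qed.

Lemma collapse_continuous (s : R) : s * s = 1 -> continuous (collapse s).
Proof.
move=> s1; apply: continuous_normalize => [|x]; last exact: collapse_vector_neq0.
apply: (@collapse_vector_continuous S idfun); exact: continuous_set_val.
Qed.

Lemma collapse_homotopic (s : R) : s * s = 1 -> homotopic R idfun (collapse s).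
Proof.
move=> s1; apply: nonantipodal_homotopic => [x|x|x]; first exact: cvg_id.
  exact: collapse_continuous.
rewrite /= set_val_normalize ?collapse_vector_neq0 // addrC.
(* Taking [l] to be the norm of the collapse vector clears the denominator of the normalized sum. *)
set k := enorm _; have k0 : 0 < k by rewrite enorm_gt0 collapse_vector_neq0.
have := collapse_vector_neq x s1 (ltW k0); apply: contra_neq => h.
by rewrite -[collapse_vector s x]scale1r -(divff (lt0r_neq0 k0)) -scalerA -scalerDr h scaler0.
Qed.

Lemma collapse_cap (s : R) (x : S) : s * s = 1 -> s * set_val x 0 ord0 <= 2^-1 ->
  collapse s x = normalize (- s *: e0).
Proof.
move=> s1 sx; rewrite /collapse /collapse_vector ler0_norm ?subr_le0 //.
rewrite addNr mul0r scale0r sub0r.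
have -> : - ((s / 8) *: e0) = (8^-1 * - s) *: e0.
  by rewrite mulrN mulrC scaleNr.
rewrite -scalerA; have sS : - s *: e0 \in S.
  apply/mem_set; rewrite /sphere /= enormZ enorm_delta mulr1 normrN.
  by apply/eqP; rewrite -(@pexpr_eq1 _ _ 2) // real_normK ?num_real // expr2 s1.
have -> : - s *: e0 = set_val (SigSub sS : S) by rewrite set_val_SigSub.
by rewrite normalizeZ ?normalizeK // invr_gt0.
Qed.

End Collapse.

Lemma eq_in_pushforward (R : realType) (X Y : topologicalType) (U : set X) n
    (f g : X -> Y) (c : chain R n X) :
  (forall x, U x -> f x = g x) -> chain_in U c -> pushforward f c = pushforward g c.
Proof.
move=> fg; apply: additive_eq_on => s [_ Us].
rewrite /= !pushforward_gen; congr gen; apply/funext => t; exact: fg.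
Qed.

Lemma small_cycle (R : realType) (X : topologicalType) (U V : set X) n
    (c : chain R n X) :
  (0 < n)%N -> open U -> open V -> (forall x, U x \/ V x) ->
  singular c -> is_cycle c ->
  exists u v, [/\ chain_in U u, chain_in V v & homologous c (u + v)].
Proof.
case: n c => // n c _ oU oV UV /singularE sc zc.
have UVT : U `|` V = setT by apply/seteqP; split=> // x _; exact: UV.
have [||_ [h [[u [v [-> Uu Vv]]] sh ->]]] := @small_chains _ _ _ _ oU oV _ c.
- by rewrite UVT.
- by rewrite zc; exact: small0.
exists u, v; split=> //; apply: homologous_boundary; apply/singularE.
by rewrite -UVT.
Qed.

(** In odd dimension a constant simplex is the boundary of the constant simplex one dimension
    higher, so [c] may be any chain. *)
Lemma constant_homologous (R : realType) (X Y : topologicalType) (y : Y) n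
    (c : chain R n X) :
  odd n -> homologous (pushforward (fun=> y) c) 0.
Proof.
move=> on; exists (gen (constant_simplex y) *~ deg c).
  by apply/singularE; apply: onMz; exact: chain_in_constant.
by rewrite subr0 pushforward_cst raddfMz /= boundary_constant on.
Qed.

Lemma homologous_product (R : realType) (A : algebra)
    (f g : sphere R (sdim A) -> sphere R (sdim A))
    (z : chain R (sdim A) (sphere R (sdim A))) :
  continuous f -> continuous g -> singular z -> is_cycle z ->
  homologous (pushforward (fun x => sphere_mul (f x) (g x)) z)
    (pushforward f z + pushforward g z).
Proof.
move=> cf cg sz zz; set S := sphere R (sdim A).
have s1 : 1 * 1 = 1 :> R by rewrite mulr1.
have s2 : -1 * -1 = 1 :> R by rewrite mulrNN mulr1.
pose p : S -> S := collapse 1; pose q : S -> S := collapse (-1).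
have [cp cq] : continuous p /\ continuous q by split; exact: collapse_continuous.
(* The two open caps cover the sphere and overlap in a band; [q] is constant on [U] and [p] on
   [V]. *)
pose U : set S := [set x : S | - 2^-1 < set_val x 0 ord0].
pose V : set S := [set x : S | set_val x 0 ord0 < 2^-1].
have cc : continuous (fun x : S => set_val x 0 ord0).
  exact: (continuous_entry (@continuous_set_val _ _)).
have oU : open U.
  apply: (@open_comp _ _ (fun x : S => set_val x 0 ord0) [set y | - 2^-1 < y]).
    by move=> x _; exact: cc.
  exact: open_gt.
have oV : open V.
  apply: (@open_comp _ _ (fun x : S => set_val x 0 ord0) [set y | y < 2^-1]).
    by move=> x _; exact: cc.
  exact: open_lt.
pose e : S := normalize (- -1 *: delta_mx 0 ord0).
pose e' : S := normalize (- 1 *: delta_mx 0 ord0).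
have qU x : U x -> q x = e.
  by rewrite /U /= => Ux; apply: collapse_cap => //; rewrite mulN1r; lra.
have pV x : V x -> p x = e'.
  by rewrite /V /= => Vx; apply: collapse_cap => //; rewrite mul1r; lra.
pose F x := sphere_mul (f (p x)) (g (q x)).
pose P x := sphere_mul (f (p x)) (g e).
pose Q x := sphere_mul (f e') (g (q x)).
pose k := sphere_mul (f e') (g e).
have cfp : continuous (f \o p).
  by move=> x; apply: continuous_comp; [exact: cp|exact: cf].
have cgq : continuous (g \o q).
  by move=> x; apply: continuous_comp; [exact: cq|exact: cg].
have cst_cont (y : S) : continuous (fun _ : S => y) by exact: cst_continuous.
have cF : continuous F by exact: continuous_sphere_mul.
have cP : continuous P by exact: continuous_sphere_mul.
have cQ : continuous Q by exact: continuous_sphere_mul.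
have hp : homotopic R idfun p by exact: collapse_homotopic s1.
have hq : homotopic R idfun q by exact: collapse_homotopic s2.
have PE : homologous (pushforward P z) (pushforward f z).
  apply: homologous_trans (homologous_mul_right (g e) cfp sz zz) _.
  apply: homologous_sym; apply: homotopic_homologous => //.
  exact: (homotopic_compl cf hp).
have QE : homologous (pushforward Q z) (pushforward g z).
  apply: homologous_trans (homologous_mul_left (f e') cgq sz zz) _.
  apply: homologous_sym; apply: homotopic_homologous => //.
  exact: (homotopic_compl cg hq).
have FE : homologous (pushforward (fun x => sphere_mul (f x) (g x)) z) (pushforward F z).
  apply: homotopic_homologous => //.
  apply: (homotopic_mul (f' := f \o p) (g' := g \o q)).
    exact: (homotopic_compl cf hp).
  exact: (homotopic_compl cg hq).
(* [P] agrees with [F] on [U] and is constant on [V]; [Q] agrees with [F] on [V] and is constant on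
   [U]. *)
suff FPQ : homologous (pushforward F z) (pushforward P z + pushforward Q z).
  by apply: homologous_trans FE (homologous_trans FPQ (homologousD PE QE)).
have UV x : U x \/ V x.
  have [x2|x2] := ltP (set_val x 0 ord0) 2^-1; first by right.
  by left; rewrite /U /=; lra.
have n0 : (0 < sdim A)%N by case: (A).
have n1 : odd (sdim A) by case: (A).
have [u [v [Uu Vv zuv]]] := small_cycle n0 oU oV UV sz zz.
have FPu : pushforward F u = pushforward P u.
  by apply: (eq_in_pushforward _ Uu) => x Ux; rewrite /F qU.
have FQv : pushforward F v = pushforward Q v.
  by apply: (eq_in_pushforward _ Vv) => x Vx; rewrite /F pV.
(* [v] need not be a cycle; oddness of the dimension alone makes its constant image bound. *)
have Pv : homologous (pushforward P v) 0.
  rewrite (eq_in_pushforward (g := fun=> k) _ Vv) => [|x Vx]; last by rewrite /P pV.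
  exact: constant_homologous n1.
have Qu : homologous (pushforward Q u) 0.
  rewrite (eq_in_pushforward (g := fun=> k) _ Uu) => [|x Ux]; last by rewrite /Q qU.
  exact: constant_homologous n1.
apply: homologous_trans (homologous_pushforward cF zuv) _.
rewrite raddfD /= FPu FQv.
apply: homologous_sym.
apply: homologous_trans (homologousD (homologous_pushforward cP zuv)
  (homologous_pushforward cQ zuv)) _.
rewrite !raddfD /= [X in _ + X]addrC.
rewrite -[X in homologous _ (X + _)]addr0 -[X in homologous _ (_ + X)]addr0.
by apply: homologousD; apply: homologousD => //; exact: homologous_refl.
Qed.

Theorem theorem3p3 (R : realType) (A : algebra)
    (f g F : sphere R (sdim A) -> sphere R (sdim A))
    (hf : smooth f) (hg : smooth g)
    (hF : forall t : sphere R (sdim A), F t = sphere_mul (f t) (g t)) :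
  degree F = degree f + degree g.
Proof.
have [cf cg] := (smooth_continuous hf, smooth_continuous hg).
have -> : F = fun t => sphere_mul (f t) (g t) by exact/funext.
have n0 : (0 < sdim A)%N by case: (A).
have [z zgen] := sphere_generator R (sdim A).
have [[zz _] /singularE sz _ _] := zgen.
apply: (degree_eq n0 zgen); first exact: continuous_sphere_mul.
apply: homologous_trans (homologous_product cf cg sz zz) _.
by rewrite mulrzDr; apply: homologousD; exact: degree_homologous.
Qed.
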